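(* Let $d\ge1$, let $g:(0,\infty)^d\to\mathbb C$ be an upper-tail potential with representing measure $\mu_g$, and let $f$ be its coordinatewise even extension to $\mathbb R^d$. Then the Abel transform $\widehat f_A(\xi)$ exists for every $\xi\in\mathbb R^d$ with no zero coordinate, and for such $\xi$ $$\widehat f_A(\xi)=2^d\int_{(0,\infty)^d}\prod_{k=1}^d\frac{\sin(t_k\xi_k)}{\xi_k}\,d\mu_g(t).$$ Consequently, for such $\xi$, $$|\widehat f_A(\xi)|\le 2^d\,\mathcal M_g(|\xi|^{-1}),\qquad |\xi|^{-1}:=(|\xi_1|^{-1},\dots,|\xi_d|^{-1}).$$ The right-hand side of the integral formula for $\widehat f_A(\xi)$, viewed as a function of $\xi$, is continuous on every compact subset of $\{\xi\in\mathbb R^d:\xi_1\cdots\xi_d\ne0\}$; in particular, $\widehat f_A$ is measurable. If $f\in L^1(\mathbb R^d)$, then $\widehat f_A=\widehat f$ almost everywhere, where $\widehat f(\xi)=\int_{\mathbb R^d}e^{ix\cdot\xi}f(x)\,dx$.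
   Context: For $x\in(0,\infty)^d$ put $\mathcal Q^*(x)=\prod_{k=1}^d[x_k,\infty)$. Upper-tail potentials. A complex Radon measure on $(0,\infty)^d$ is understood locally (its total variation $|\mu|$ is finite on compact sets but not necessarily on the whole space). A measurable function $g:(0,\infty)^d\to\mathbb C$ is an upper-tail potential if there is a complex Radon measure $\mu_g$ on $(0,\infty)^d$ such that $g(x)=\mu_g(\mathcal Q^*(x))$ for almost every $x$ and $$\mathcal M_g(r):=\int_{(0,\infty)^d}\prod_{k=1}^d\min\{r_k,t_k\}\,d|\mu_g|(t)<\infty\quad\text{for every }r\in(0,\infty)^d.$$ The second condition implies $|\mu_g|(\mathcal Q^*(x))<\infty$ for every $x$. The measure $\mu_g$ is uniquely determined by the almost-everywhere class of $g$, and $g$ is always represented by its canonical version $g(x)=\mu_g(\mathcal Q^*(x))$ for every $x$. Even extension. $f(x)=g(|x_1|,\dots,|x_d|)$ when $x_1\cdots x_d\ne0$; the values on the coordinate hyperplanes are arbitrary measurable values (irrelevant almost everywhere). Abel Fourier transform. For $\varepsilon\in(0,\infty)^d$ put $\widehat f_\varepsilon(\xi)=\int_{\mathbb R^d}f(x)e^{-\sum_k\varepsilon_k|x_k|}e^{ix\cdot\xi}\,dx$. For $\xi$ with no zero coordinate, $\widehat f_A(\xi)=\lim_{\varepsilon\to0+}\widehat f_\varepsilon(\xi)$, provided the limit exists, where $\varepsilon\to0+$ means that $\varepsilon_k\downarrow0$ for every $k$ along an arbitrary path in $(0,\infty)^d$; existence includes independence of the path. If some $\xi_k=0$, set $\widehat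 f_A(\xi)=0$. *)

(* Defs.v *)
From HB Require Import structures.
From mathcomp Require Import all_boot all_order all_algebra.
From mathcomp Require Import all_classical all_reals all_analysis.
From mathcomp Require Import complex.

Set Implicit Arguments.
Unset Strict Implicit.
Unset Printing Implicit Defensive.

Import Order.TTheory GRing.Theory Num.Theory.
Import numFieldNormedType.Exports.

Local Open Scope classical_set_scope.
Local Open Scope ring_scope.

(* [R[i]] gets the topology of its norm (MathComp-Analysis only provides it on
   the alias [R[i]^o]). *)
HB.instance Definition _ (R : realType) := NormedModule.copy R[i] R[i]^o.

Definition rV_display : measure_display -> measure_display.
Proof. exact. Qed.

Section measurable_rV.
Context {d} {T : measurableType d} (n : nat).

Let coord : 'I_n -> 'rV[T]_n -> T := fun i x => x ord0 i.

Let rV_set0 : g_sigma_preimage coord set0.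
Proof. exact: sigma_algebra0. Qed.

Let rV_setC A : g_sigma_preimage coord A -> g_sigma_preimage coord (~` A).
Proof. exact: sigma_algebraC. Qed.

Let rV_bigcup (F : _^nat) : (forall i, g_sigma_preimage coord (F i)) ->
  g_sigma_preimage coord (\bigcup_i (F i)).
Proof. exact: sigma_algebra_bigcup. Qed.

(* The product sigma-algebra; for [T] = [R] it is the Borel sigma-algebra. *)
HB.instance Definition _ := @isMeasurable.Build (rV_display d)
  'rV[T]_n (g_sigma_preimage coord) rV_set0 rV_setC rV_bigcup.

End measurable_rV.

Definition rV_cons (T : Type) (n : nat) (p : T * 'rV[T]_n) : 'rV[T]_n.+1 :=
  \row_j (if unlift ord0 j is Some k then p.2 ord0 k else p.1).

Definition rV_uncons (T : Type) (n : nat) (v : 'rV[T]_n.+1) : T * 'rV[T]_n :=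
  (v ord0 ord0, \row_k v ord0 (lift ord0 k)).

Lemma rV_consK (T : Type) (n : nat) : cancel (@rV_cons T n) (@rV_uncons T n).
Proof.
move=> [x v]; rewrite /rV_uncons mxE unlift_none; congr pair.
by apply/rowP => k; rewrite !mxE liftK.
Qed.

Lemma rV_unconsK (T : Type) (n : nat) : cancel (@rV_uncons T n) (@rV_cons T n).
Proof.
by move=> v; apply/rowP => j; rewrite mxE; case: unliftP => [k ->|->]; rewrite ?mxE.
Qed.

Section measurable_rV_lemmas.
Context d (T : measurableType d).

Lemma measurable_rV_coord n (i : 'I_n) :
  measurable_fun [set: 'rV[T]_n] (fun x => x ord0 i).
Proof.
move=> _ Y mY; rewrite setTI; apply: sub_sigma_algebra => /=.
rewrite -bigcup_seq/=; exists i => /=; first by rewrite mem_index_enum.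
by exists Y => //; rewrite setTI.
Qed.

Lemma measurable_fun_rVP d1 (T1 : measurableType d1) n (f : T1 -> 'rV[T]_n) :
  (forall i, measurable_fun setT (fun x => f x ord0 i)) -> measurable_fun setT f.
Proof.
move=> mf _ A mA; rewrite setTI.
have : (image_set_system setT f measurable : set (set 'rV[T]_n)) A.
  move: A mA; apply: smallest_sub.
    by apply: sigma_algebra_image; exact: sigma_algebra_measurable.
  rewrite -bigcup_seq => _ [i _ [B mB <-]].
  by have := mf i measurableT B mB; rewrite /image_set_system/= !setTI.
by rewrite /image_set_system/= setTI.
Qed.

Lemma measurable_rV_cons n : measurable_fun setT (@rV_cons T n).
Proof.
apply: measurable_fun_rVP => j; rewrite /rV_cons.
under [X in measurable_fun _ X]eq_fun do rewrite mxE.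
case: unlift => [k|]; last exact: measurable_fst.
exact: (measurableT_comp (measurable_rV_coord k) measurable_snd).
Qed.

Lemma measurable_rV_uncons n : measurable_fun setT (@rV_uncons T n).
Proof.
apply/measurable_fun_pairP; split => /=; first exact: measurable_rV_coord.
apply: measurable_fun_rVP => k /=.
under [X in measurable_fun _ X]eq_fun do rewrite mxE.
exact: measurable_rV_coord.
Qed.

End measurable_rV_lemmas.

Lemma product_measure_sigma_finite d1 d2 (T1 : measurableType d1)
    (T2 : measurableType d2) (R : realType)
    (m1 : {sigma_finite_measure set T1 -> \bar R})
    (m2 : {sigma_finite_measure set T2 -> \bar R}) :
  sigma_finite setT (m1 \x m2)%E.
Proof.
have /sigma_finiteP[F [TF ndF Foo]] := sigma_finiteT m1.
have /sigma_finiteP[G [TG ndG Goo]] := sigma_finiteT m2.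
exists (fun n => F n `*` G n).
  rewrite -setXTT TF TG predeqE => -[x y]; split.
    move=> [/= [n _ Fnx] [k _ Gky]]; exists (maxn n k) => //; split.
    - by move: x Fnx; exact/subsetPset/ndF/leq_maxl.
    - by move: y Gky; exact/subsetPset/ndG/leq_maxr.
  by move=> [n _ []/= ? ?]; split; exists n.
move=> k; have [? ?] := Foo k; have [? ?] := Goo k; split.
  exact: measurableX.
by rewrite product_measure1E// lte_mul_pinfty// ge0_fin_numE.
Qed.

Lemma pushforward_sigma_finite d1 d2 (T1 : measurableType d1)
    (T2 : measurableType d2) (R : realType)
    (m : {measure set T1 -> \bar R}) (f : T1 -> T2) (g : T2 -> T1) :
  sigma_finite setT m ->
  measurable_fun setT f -> measurable_fun setT g -> cancel f g ->
  exists q : {sigma_finite_measure set T2 -> \bar R},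
    q = pushforward m f :> (set T2 -> \bar R).
Proof.
move=> [F FT Foo] mf mg fK.
have sf : sigma_finite setT (pushforward m f).
  exists (fun k => g @^-1` F k).
    by rewrite -preimage_bigcup -FT preimage_setT.
  move=> k; have [mF Fk] := Foo k; split.
    by rewrite -[X in measurable X]setTI; exact: mg.
  rewrite /pushforward -comp_preimage (_ : g \o f = id) ?preimage_id//.
  by apply/funext => x /=; rewrite fK.
have [pf pfE] : exists pf : {measure set T2 -> \bar R},
    pf = pushforward m f :> (set T2 -> \bar R).
  by exists (@measure_function_pushforward__canonical__measure_function_Measure
    _ _ _ _ _ m _ mf).
rewrite -pfE in sf *.
pose H1 := isSFinite.Build _ _ _ (pf : set _ -> _)
  (sfinite_measure_sigma_finite sf).
pose H2 := isSigmaFinite.Build _ _ _ (pf : set _ -> _) sf.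
by exists (HB.pack_for (sigma_finite_measure T2 R) (Measure.sort pf) H1 H2).
Qed.

Section lebesgue_rV.
Context (R : realType).
Local Open Scope ereal_scope.

Fixpoint lebesgue_rV (n : nat) : set 'rV[R]_n -> \bar R :=
  if n is m.+1 then
    pushforward (@lebesgue_measure R \x @lebesgue_rV m) (@rV_cons R m)
  else dirac (0%R : 'rV[R]_0).

Let lebesgue_rV_sigma_finite_measure n :
  exists m : {sigma_finite_measure set 'rV[R]_n -> \bar R},
    m = @lebesgue_rV n :> (set 'rV[R]_n -> \bar R).
Proof.
elim: n => [|n [m mE]]; first by exists (dirac (0%R : 'rV[R]_0)).
have [q qE] := pushforward_sigma_finite
  (product_measure_sigma_finite (@lebesgue_measure R) m)
  (@measurable_rV_cons _ R n) (@measurable_rV_uncons _ R n) (@rV_consK R n).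
by exists q; rewrite qE /= mE.
Qed.

Let lebesgue_rV0 n : lebesgue_rV (@set0 'rV[R]_n) = 0.
Proof. by have [m <-] := lebesgue_rV_sigma_finite_measure n; exact: measure0. Qed.

Let lebesgue_rV_ge0 n (A : set 'rV[R]_n) : 0 <= lebesgue_rV A.
Proof. by have [m <-] := lebesgue_rV_sigma_finite_measure n; exact: measure_ge0. Qed.

Let lebesgue_rV_sigma_additive n : semi_sigma_additive (@lebesgue_rV n).
Proof.
have [m <-] := lebesgue_rV_sigma_finite_measure n.
exact: measure_semi_sigma_additive.
Qed.

HB.instance Definition _ n := isMeasure.Build _ _ _ (@lebesgue_rV n)
  (@lebesgue_rV0 n) (@lebesgue_rV_ge0 n) (@lebesgue_rV_sigma_additive n).

Let lebesgue_rV_sigma_finite n : sigma_finite setT (@lebesgue_rV n).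
Proof.
by have [m <-] := lebesgue_rV_sigma_finite_measure n; exact: sigma_finiteT.
Qed.

HB.instance Definition _ n := Measure_isSigmaFinite.Build _ _ _ (@lebesgue_rV n)
  (@lebesgue_rV_sigma_finite n).

Lemma lebesgue_rV_box n (a b : 'rV[R]_n) :
  (forall i, (a ord0 i <= b ord0 i)%R) ->
  lebesgue_rV [set x : 'rV[R]_n | forall i, x ord0 i \in `[a ord0 i, b ord0 i]] =
  (\prod_i (b ord0 i - a ord0 i))%:E.
Proof.
elim: n => [|n IH] in a b * => ab /=.
  by rewrite big_ord0 /dirac indicE mem_set//= => -[].
rewrite /pushforward (_ : _ @^-1` _ = `[a ord0 ord0, b ord0 ord0] `*`
    [set x : 'rV[R]_n | forall i, x ord0 i \in
      `[(rV_uncons a).2 ord0 i, (rV_uncons b).2 ord0 i]]); last first.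
  apply/seteqP; split => -[x v] /=.
    move=> H; split => /=; first by have := H ord0; rewrite mxE unlift_none.
    by move=> i; have := H (lift ord0 i); rewrite !mxE liftK.
  move=> [/= x0 xS] i; rewrite mxE; case: unliftP => [k ->|->] //.
  by have := xS k; rewrite !mxE.
rewrite product_measure1E//=; last first.
  rewrite (_ : mkset _ = \bigcap_(i in [set: 'I_n])
    ((fun x : 'rV[R]_n => x ord0 i) @^-1`
      `[(rV_uncons a).2 ord0 i, (rV_uncons b).2 ord0 i])); last first.
    by apply/seteqP; split => x /= H i => [_|]; exact: H.
  apply: fin_bigcap_measurable => //= i _; rewrite -[X in measurable X]setTI.
  exact: measurable_rV_coord.
rewrite lebesgue_measure_itv/= lte_fin big_ord_recl EFinM IH; last first.
  by move=> i; rewrite !mxE.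
congr (_ * _).
  by case: ltgtP (ab ord0) => // ->; rewrite subrr.
by congr EFin; apply: eq_bigr => i _; rewrite !mxE.
Qed.

End lebesgue_rV.

Section complex_functions.
Context (R : realType) (n : nat).
Implicit Types (D : set 'rV[R]_n) (f : 'rV[R]_n -> R[i]) (xi x : 'rV[R]_n).

Definition cmeasurable D f :=
  measurable_fun D (fun x => complex.Re (f x)) /\
  measurable_fun D (fun x => complex.Im (f x)).

(* For measurable [f] this is the finiteness of the integral of the modulus. *)
Definition cintegrable D f :=
  (@lebesgue_rV R n).-integrable D (fun x => (complex.Re (f x))%:E) /\
  (@lebesgue_rV R n).-integrable D (fun x => (complex.Im (f x))%:E).

Definition cintegral D f : R[i] :=
  ((\int[@lebesgue_rV R n]_(x in D) complex.Re (f x))%R +i*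
   (\int[@lebesgue_rV R n]_(x in D) complex.Im (f x))%R)%C.

Definition dot x xi : R := \sum_k x ord0 k * xi ord0 k.

Definition expi (t : R) : R[i] := (cos t +i* sin t)%C.

Definition fourier f xi : R[i] :=
  cintegral setT (fun x => f x * expi (dot x xi)).

Definition orthant : set 'rV[R]_n := [set x | forall k, 0 < x ord0 k].

Definition no_zero_coord : set 'rV[R]_n := [set x | forall k, x ord0 k != 0].

Definition abs_coord x : 'rV[R]_n := \row_k `|x ord0 k|.

Definition inv_abs_coord x : 'rV[R]_n := \row_k `|x ord0 k|^-1.

Definition abel_integrand f (xi eps x : 'rV[R]_n) : R[i] :=
  f x * (expR (- \sum_k eps ord0 k * `|x ord0 k|))%:C%C * expi (dot x xi).

Definition fourier_eps f (xi eps : 'rV[R]_n) : R[i] :=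
  cintegral setT (abel_integrand f xi eps).

(* eps -> 0+ : the trace on the open orthant of the neighborhoods of 0; a limit
   along this filter is a path-independent limit. *)
Definition abel_filter : set_system 'rV[R]_n := within orthant (nbhs (0 : 'rV[R]_n)).

(* Existence of the Abel transform includes the absolute convergence of the
   regularized integrals. *)
Definition abel_exists f xi :=
  (forall eps, orthant eps -> cintegrable setT (abel_integrand f xi eps)) /\
  cvg (fourier_eps f xi @ abel_filter).

Definition abel_fourier f xi : R[i] :=
  if `[< no_zero_coord xi >] then lim (fourier_eps f xi @ abel_filter) else 0.

End complex_functions.

Arguments orthant {R n}.
Arguments no_zero_coord {R n}.

Section complex_radon.
Context (R : realType) (n : nat).
Implicit Types (A B K : set 'rV[R]_n) (mu : set 'rV[R]_n -> R[i]).

Definition relcompact A :=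
  measurable A /\ exists K, [/\ compact K, K `<=` orthant & A `<=` K].

Definition total_variation mu A : \bar R :=
  ereal_sup [set y | exists (m : nat) (F : nat -> set 'rV[R]_n),
    [/\ forall k, (k < m)%N -> relcompact (F k) /\ F k `<=` A,
        trivIset `I_m F &
        y = (\sum_(k < m) Normc.normc (mu (F k)))%:E]].

(* A local complex measure is a set function on the relatively compact Borel
   subsets of the orthant; the values of [radon_val] on other sets are
   meaningless. No regularity is required since a locally finite Borel measure
   on an open subset of R^n is automatically regular. *)
Record complex_radon := ComplexRadon {
  radon_val : set 'rV[R]_n -> R[i] ;
  radon_sigma_additive : forall F : nat -> set 'rV[R]_n,
    (forall k, relcompact (F k)) -> trivIset setT F ->
    relcompact (\bigcup_k F k) ->
    (fun m => \sum_(k < m) radon_val (F k)) @ \oo -->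
      radon_val (\bigcup_k F k) ;
  radon_locally_finite : forall K, compact K -> K `<=` orthant ->
    (total_variation radon_val K < +oo)%E }.

Definition radon_variation (nu : complex_radon) : set 'rV[R]_n -> \bar R :=
  total_variation (radon_val nu).

(* The upper variation, i.e. the positive part of the Jordan decomposition of a
   real set function; the negative part is that of the opposite. *)
Definition upper_variation (s : set 'rV[R]_n -> R) A : \bar R :=
  ereal_sup [set (s B)%:E | B in [set B | relcompact B /\ B `<=` A]].

(* Integral of a real function: the combination of the integrals with respect
   to the Jordan parts of the real and imaginary parts. The set functions
   [upper_variation] and [radon_variation] are (positive) Borel measures that
   do not charge the complement of the orthant. *)
Definition radon_integral (nu : complex_radon) (f : 'rV[R]_n -> R) : R[i] :=
  let I (s : set 'rV[R]_n -> R) :=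
    fine (\int[upper_variation s]_(t in orthant) (f t)%:E)%E in
  let re B := complex.Re (radon_val nu B) in
  let im B := complex.Im (radon_val nu B) in
  ((I re - I (fun B => - re B)) +i* (I im - I (fun B => - im B)))%C.

Definition radon_integrable (nu : complex_radon) (f : 'rV[R]_n -> R) :=
  (radon_variation nu).-integrable orthant (fun t => (f t)%:E).

(* The extension of [radon_val nu] to the Borel sets of finite variation, such
   as [upper_box x] below. *)
Definition radon_measure (nu : complex_radon) A : R[i] :=
  radon_integral nu (\1_A).

Definition upper_box (x : 'rV[R]_n) : set 'rV[R]_n :=
  [set t | forall k, x ord0 k <= t ord0 k].

Definition tail_moment (nu : complex_radon) (r : 'rV[R]_n) : \bar R :=
  (\int[radon_variation nu]_(t in orthant)
     (\prod_k Num.min (r ord0 k) (t ord0 k))%:E)%E.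

(* [g] is an upper-tail potential with representing measure [nu]; only the
   values of [g] on the orthant matter. *)
Definition upper_tail_potential (g : 'rV[R]_n -> R[i]) (nu : complex_radon) :=
  [/\ cmeasurable orthant g,
      {ae @lebesgue_rV R n,
         forall x, orthant x -> g x = radon_measure nu (upper_box x)} &
      forall r, orthant r -> (tail_moment nu r < +oo)%E].

(* The values on the coordinate hyperplanes are left free. *)
Definition even_extension (g f : 'rV[R]_n -> R[i]) :=
  cmeasurable setT f /\
  forall x, no_zero_coord x -> f x = g (abs_coord x).

Definition sin_kernel (xi t : 'rV[R]_n) : R :=
  \prod_k (sin (t ord0 k * xi ord0 k) / xi ord0 k).

End complex_radon.

(* Main.v *)
Require Import Defs.
From HB Require Import structures.
From mathcomp Require Import all_boot all_order all_algebra.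
From mathcomp Require Import all_classical all_reals all_analysis.
From mathcomp Require Import measurable_realfun complex lra ring.
Import Order.TTheory GRing.Theory Num.Theory.
Import numFieldNormedType.Exports.
Local Open Scope classical_set_scope.
Local Open Scope ring_scope.

Set Implicit Arguments.
Unset Strict Implicit.
Unset Printing Implicit Defensive.

(** The tail [g] is a superposition of indicator functions of boxes: for almost
    every [x] one has [g (|x|) = mu {t | |x_k| <= t_k for all k}], so that the
    regularized transform of [f] is formally the integral against [mu] of the
    regularized transform of the box [prod_k [-t_k, t_k]].  That transform is a
    product of the one-dimensional integrals
      [abel_kernel e b t = int_{-t}^t exp(- e |x|) cos (x b) dx],
    which are explicit.  From the closed form, [abel_kernel e b t] tends to
    [2 sin (t b) / b] when [e] tends to [0], and its absolute value is at most
    [4 min (1 / |b|, t)] uniformly in [e].  The finiteness of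
    [tail_moment mu] at [1 / e] is exactly what is required to interchange
    the integrals for a fixed regularization [e] (take [b = 0], where the bound
    is [4 min (1 / e, t)]), and its finiteness at [1 / |xi|] provides the
    dominating function for the passage to the limit.  No path has to be
    chosen: a limit along the trace on the orthant of the neighbourhoods of [0]
    can be tested on sequences, to which dominated convergence applies.

    The measure theory is done with positive measures.  The upper variations of
    the real and imaginary parts of [mu] and of their opposites, and the total
    variation, are shown to be sigma-finite measures on the whole space
    (superadditivity plus countable subadditivity).  On relatively compact sets
    a real set function is the difference of its two upper variations, which
    gives the inequality [|int k dmu| <= int |k| d|mu|]: it is obtained from an
    inequality between positive measures by moving the negative terms to the
    other side ([le_integral_jordan], [radon_jordan]).  Fubini's theorem is
    then applied to each of the four Jordan parts ([damped_tail_int],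
    [fourier_eps_abel_kernel]).

    Continuity of the sine integral in [xi] is again dominated convergence,
    with a bound that is uniform near a point with no zero coordinate, its
    measurability comes from Tonelli's theorem, and for an integrable [f] the
    factor [exp (- sum_k eps_k |x_k|)] is bounded by [1] and tends to [1], so
    that the Abel limit is the ordinary Fourier integral. *)

(** * Limits of complex functions and limits along traces of neighbourhoods *)

Section complex_cvg.
Context (R : realType).
Implicit Types z w : R[i].

Lemma normr_Re_le z : `|complex.Re z| <= Normc.normc z.
Proof.
case: z => a b /=; rewrite -sqrtr_sqr ler_wsqrtr// lerDl.
exact: sqr_ge0.
Qed.

Lemma normr_Im_le z : `|complex.Im z| <= Normc.normc z.
Proof.
case: z => a b /=; rewrite -sqrtr_sqr ler_wsqrtr// lerDr.
exact: sqr_ge0.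
Qed.

Lemma normc_le_add z : Normc.normc z <= `|complex.Re z| + `|complex.Im z|.
Proof.
case: z => a b /=.
rewrite -(@ger0_norm _ (`|a| + `|b|)) ?addr_ge0// -sqrtr_sqr ler_wsqrtr//.
rewrite sqrrD !real_normK ?num_real// lerD2r lerDl.
by rewrite mulrn_wge0// mulr_ge0.
Qed.

Lemma normc_ge0 z : 0 <= Normc.normc z.
Proof. exact: le_trans (normr_ge0 _) (normr_Re_le z). Qed.

Lemma normr_complex z : `|z| = (Normc.normc z)%:C%C.
Proof. by []. Qed.

Lemma cvg_complexP (T : Type) (F : set_system T) (FF : Filter F)
    (u : T -> R[i]) z :
  u x @[x --> F] --> z <->
  (complex.Re (u x) @[x --> F] --> complex.Re z) /\
  (complex.Im (u x) @[x --> F] --> complex.Im z).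
Proof.
split=> [/cvgrPdist_lt uz|[/cvgrPdist_lt ur /cvgrPdist_lt ui]].
  split; apply/cvgrPdist_lt => e e0.
    have /uz : 0 < (e%:C)%C :> R[i] by rewrite ltcR.
    apply: filterS => t; rewrite normr_complex ltcR; apply: le_lt_trans.
    by rewrite -raddfB normr_Re_le.
  have /uz : 0 < (e%:C)%C :> R[i] by rewrite ltcR.
  apply: filterS => t; rewrite normr_complex ltcR; apply: le_lt_trans.
  by rewrite -raddfB normr_Im_le.
apply/cvgrPdist_lt => e; rewrite ltcE /= => /andP[/eqP e0 eR].
have eE : e = ((complex.Re e)%:C)%C by case: (e) e0 => ? ? /= ->.
have e2 : 0 < complex.Re e / 2 by rewrite divr_gt0.
apply: filterS2 (ur _ e2) (ui _ e2) => t tr ti.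
rewrite eE normr_complex ltcR (le_lt_trans (normc_le_add _))// !raddfB/=.
by rewrite (splitr (complex.Re e)) ltrD.
Qed.

Lemma cvg_normc (T : Type) (F : set_system T) (FF : Filter F)
    (u : T -> R[i]) z :
  u x @[x --> F] --> z -> Normc.normc (u x) @[x --> F] --> Normc.normc z.
Proof.
move=> /cvgrPdist_lt uz; apply/cvgrPdist_lt => e e0.
have /uz : 0 < (e%:C)%C :> R[i] by rewrite ltcR.
apply: filterS => t; rewrite normr_complex ltcR; apply: le_lt_trans.
have sub (a b : R[i]) : Normc.normc a - Normc.normc b <= Normc.normc (a - b).
  by rewrite lerBlDr -[X in Normc.normc X <= _](subrK b) le_normcD.
by rewrite ler_norml sub lerNl opprB -[X in _ <= X]normcN opprB sub.
Qed.

End complex_cvg.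

(** The balls of radius [1 / (n + 1)] form a countable base of neighbourhoods:
    choosing a bad point in each of them would give a bad sequence. *)
Lemma cvg_within_seq (R : realType) (U : pseudoMetricType R) (a : U)
    (A : set U) (h : U -> R) (l : R) :
  (forall u : nat -> U, (forall n, A (u n)) -> u @ \oo --> a ->
     h (u n) @[n --> \oo] --> l) ->
  h x @[x --> within A (nbhs a)] --> l.
Proof.
move=> H; apply/cvgrPdist_lt => e e0; apply: contrapT => hF.
have {}hF n : exists x, [/\ A x, ball a (n.+1%:R^-1) x & e <= `|l - h x|].
  apply: contrapT => hn; apply: hF.
  rewrite near_withinE.
  have : nbhs a (ball a (n.+1%:R^-1 : R)) by apply: nbhsx_ballx; rewrite invr_gt0.
  apply: filterS => x bx Ax.
  by rewrite ltNge; apply/negP => eh; apply: hn; exists x.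
pose u n := sval (cid (hF n)).
have uP n : [/\ A (u n), ball a (n.+1%:R^-1) (u n) & e <= `|l - h (u n)|].
  by rewrite /u; case: cid.
have ua : u @ \oo --> a.
  apply/cvg_ballP => d d0; near=> n; have [_ + _] := uP n.
  apply: le_ball; apply: ltW; near: n.
  exact: (near_infty_natSinv_lt (PosNum d0)).
have /cvgrPdist_lt/(_ _ e0)[N _ /(_ N (leqnn N))] := H u (fun n => let: And3 p _ _ := uP n in p) ua.
by have [_ _ +] := uP N; rewrite leNgt => /negP.
Unshelve. all: by end_near. Qed.

(** * Relatively compact sets and a criterion for sigma-additivity *)

Section relatively_compact.
Context (R : realType) (n : nat).
Implicit Types A B : set 'rV[R]_n.

Lemma measurable_coordwise (C : 'I_n -> set R) : (forall i, measurable (C i)) ->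
  measurable [set t : 'rV[R]_n | forall i, C i (t ord0 i)].
Proof.
move=> mC; rewrite (_ : mkset _ = \bigcap_(i in [set: 'I_n])
    ((fun t : 'rV[R]_n => t ord0 i) @^-1` C i)); last first.
  by apply/seteqP; split => t /= H i => [_|]; exact: H.
apply: fin_bigcap_measurable => //= i _; rewrite -[X in measurable X]setTI.
exact: measurable_rV_coord.
Qed.

Lemma measurable_orthant : measurable (@orthant R n).
Proof.
rewrite (_ : orthant =
  [set t : 'rV[R]_n | forall i, `]0, +oo[%classic (t ord0 i)]).
  exact: (@measurable_coordwise (fun=> `]0, +oo[%classic)).
by apply/seteqP; split => t /= tP i; have := tP i; rewrite in_itv/= andbT.
Qed.

Lemma relcompact_measurable A : relcompact A -> measurable A.
Proof. by case. Qed.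

Lemma relcompact_orthant A : relcompact A -> A `<=` orthant.
Proof. by case=> _ [K [_ KO AK]]; exact: subset_trans KO. Qed.

Lemma relcompact_sub A B : measurable A -> A `<=` B -> relcompact B ->
  relcompact A.
Proof.
move=> mA AB [_ [K [cK KO BK]]]; split => //; exists K; split => //.
exact: subset_trans BK.
Qed.

Lemma relcompact0 : relcompact (set0 : set 'rV[R]_n).
Proof.
by split => //; exists set0; split => //; exact: compact0.
Qed.

Lemma relcompactU A B : relcompact A -> relcompact B -> relcompact (A `|` B).
Proof.
move=> [mA [K [cK KO AK]]] [mB [L [cL LO BL]]]; split; first exact: measurableU.
exists (K `|` L); split; first exact: compactU.
  by rewrite subUset.
exact: setUSS.
Qed.

(** A countable exhaustion of the orthant by compact sets, which reduces
    statements on Borel sets to relatively compact ones. *)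
Definition cube (j : nat) : set 'rV[R]_n :=
  [set t : 'rV[R]_n | forall i, `[j.+1%:R^-1, j.+1%:R]%classic (t ord0 i)].

Lemma relcompact_cube j : relcompact (cube j).
Proof.
split.
  exact: (@measurable_coordwise (fun=> `[j.+1%:R^-1, j.+1%:R]%classic)).
exists (cube j); split => //.
  exact: (@rV_compact R n (fun=> `[j.+1%:R^-1, j.+1%:R]%classic)
      (fun=> @segment_compact _ _ _)).
move=> t jt i; have := jt i; rewrite /= in_itv/= => /andP[+ _].
by apply: lt_le_trans; rewrite invr_gt0.
Qed.

Lemma nondecreasing_cube : nondecreasing_seq cube.
Proof.
move=> i j ij; apply/subsetPset => t it k; have := it k.
rewrite /= !in_itv/= => /andP[ti tj]; apply/andP; split.
  by apply: le_trans ti; rewrite lef_pV2 ?posrE// ler_nat.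
by apply: le_trans tj _; rewrite ler_nat.
Qed.

Lemma bigcup_cube : \bigcup_j cube j = orthant.
Proof.
apply/seteqP; split => [t [j _]|t tO].
  exact: (relcompact_orthant (relcompact_cube j)).
pose M := \sum_i ((t ord0 i)^-1 + t ord0 i).
have tM i : (t ord0 i)^-1 + t ord0 i <= M.
  rewrite /M (bigD1 i)//= lerDl sumr_ge0// => j _.
  by rewrite addr_ge0// ?invr_ge0 ltW.
exists (Num.truncn M) => // i.
have MN : M <= (Num.truncn M).+1%:R by apply/ltW; exact: truncnS_gt.
have ti0 := tO i.
rewrite /= in_itv/= invf_ple ?posrE//; apply/andP; split; apply: le_trans MN;
  apply: le_trans (tM i).
  by rewrite lerDl ltW.
by rewrite lerDr invr_ge0 ltW.
Qed.

End relatively_compact.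
Arguments measurable_orthant {R n}.
Arguments relcompact_measurable {R n A} _ : rename.
Arguments relcompact_cube {R n} j.

Section measure_criterion.
Local Open Scope ereal_scope.

(** The hypotheses make both suprema nonnegative, so that they are either
    infinite or real and the two can be taken one after the other. *)
Lemma ereal_supD_le (R : realType) (A B : set (\bar R)) c :
  A 0 -> B 0 -> (forall b, B b -> b \is a fin_num) ->
  (forall a b, A a -> B b -> a + b <= c) -> ereal_sup A + ereal_sup B <= c.
Proof.
move=> A0 B0 Bfin ABc.
have c0 : 0 <= c by rewrite -(adde0 0); exact: ABc.
case: c c0 ABc => [c c0 ABc|_ _|//]; last exact: leey.
have sA0 : 0 <= ereal_sup A by exact: ereal_sup_ubound.
have sAc : ereal_sup A <= c%:E.
  by apply: ge_ereal_sup => a Aa; rewrite -(adde0 a) ABc.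
have sAfin : ereal_sup A \is a fin_num.
  by rewrite ge0_fin_numE// (le_lt_trans sAc)// ltry.
rewrite addeC -leeBrDr//; apply: ge_ereal_sup => b Bb.
rewrite leeBrDr// addeC -leeBrDr ?Bfin//; apply: ge_ereal_sup => a Aa.
by rewrite leeBrDr ?Bfin// ABc.
Qed.

(** Superadditivity bounds the partial sums from above, subadditivity bounds
    the value on the union: together they are sigma-additivity. *)
Lemma superadditive_semi_sigma_additive d (T : measurableType d) (R : realType)
    (phi : set T -> \bar R) :
  phi set0 = 0 -> (forall A, 0 <= phi A) ->
  (forall A B, measurable A -> measurable B -> A `&` B = set0 ->
     phi A + phi B <= phi (A `|` B)) ->
  (forall F : nat -> set T, (forall k, measurable (F k)) -> trivIset setT F ->
     phi (\bigcup_k F k) <= \sum_(0 <= k <oo) phi (F k)) ->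
  semi_sigma_additive phi.
Proof.
move=> phi0 phi_ge0 phiD phi_sub F mF tF mUF.
have phi_mono A B : measurable A -> measurable B -> A `<=` B -> phi A <= phi B.
  move=> mA mB AB; have := phiD A (B `\` A) mA (measurableD mB mA).
  rewrite setDIK => /(_ erefl); rewrite setDUK//; apply: le_trans.
  by rewrite leeDl.
have phi_sum m : \sum_(0 <= k < m) phi (F k) <= phi (\big[setU/set0]_(k < m) F k).
  elim: m => [|m IH]; first by rewrite big_geq// phi_ge0.
  rewrite big_nat_recr//= big_ord_recr/=.
  apply: (@le_trans _ _ (phi (\big[setU/set0]_(k < m) F k) + phi (F m))).
    by rewrite leeD2r.
  apply: phiD => //; first exact: bigsetU_measurable.
  by apply: (@trivIset_bigsetUI _ predT) => // i j _ _; exact: tF.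
have cF : cvgn (fun m => \sum_(0 <= k < m) phi (F k)).
  by apply: is_cvg_nneseries => *; exact: phi_ge0.
rewrite (_ : phi _ = \sum_(0 <= k <oo) phi (F k)) //.
apply/eqP; rewrite eq_le phi_sub//=; apply: lime_le => //.
apply: nearW => m; apply: le_trans (phi_sum m) _.
apply: phi_mono => //; first exact: bigsetU_measurable.
exact: bigsetU_bigcup.
Qed.

Lemma exists_sigma_finite_measure d (T : measurableType d) (R : realType)
    (phi : set T -> \bar R) :
  phi set0 = 0 -> (forall A, 0 <= phi A) -> semi_sigma_additive phi ->
  sigma_finite setT phi ->
  exists P : {sigma_finite_measure set T -> \bar R}, P = phi :> (set T -> \bar R).
Proof.
move=> phi0 phi_ge0 phi_add phi_sf.
pose H1 := isMeasure.Build _ _ _ phi phi0 phi_ge0 phi_add.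
pose pm : {measure set T -> \bar R} := HB.pack_for (measure T R) phi H1.
have sf : sigma_finite setT pm by [].
pose H2 := isSFinite.Build _ _ _ (pm : set _ -> _)
  (sfinite_measure_sigma_finite sf).
pose H3 := isSigmaFinite.Build _ _ _ (pm : set _ -> _) sf.
by exists (HB.pack_for (sigma_finite_measure T R) (Measure.sort pm) H2 H3).
Qed.

Lemma sigma_finite_orthant (R : realType) n (phi : set 'rV[R]_n -> \bar R) :
  phi (~` orthant) = 0 -> (forall A, relcompact A -> phi A < +oo) ->
  sigma_finite setT phi.
Proof.
move=> phi0 phioo.
exists (fun k => if k is j.+1 then @cube R n j else ~` @orthant R n).
  apply/esym/seteqP; split => // t _.
  have [tO|tO] := pselect (orthant t); last by exists 0%N.
  by have := tO; rewrite -bigcup_cube => -[j _ tj]; exists j.+1.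
move=> [|j]; split.
- by apply: measurableC; exact: measurable_orthant.
- by rewrite phi0.
- exact: (relcompact_measurable (relcompact_cube j)).
- by apply: phioo; exact: (relcompact_cube j).
Qed.

End measure_criterion.

(** * The upper variation of a real set function *)

(** The property of the real and imaginary parts of a complex Radon measure, and
    of their opposites, on which the theory of the upper variation rests. *)
Definition locally_sigma_additive (R : realType) n (s : set 'rV[R]_n -> R) :=
  forall F : nat -> set 'rV[R]_n,
    (forall k, relcompact (F k)) -> trivIset setT F ->
    relcompact (\bigcup_k F k) ->
    \sum_(k < m) s (F k) @[m --> \oo] --> s (\bigcup_k F k).

Lemma cvg_EFin_le (R : realType) (w : nat -> R) (l : R) (c : \bar R) :
  w @ \oo --> l -> (forall m, (w m)%:E <= c)%E -> (l%:E <= c)%E.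
Proof.
move=> wl; case: c => [c wc|_|wc]; last by have := wc 0%N; rewrite leeNy_eq.
- rewrite lee_fin -(cvg_lim (@Rhausdorff R) wl); apply: limr_le.
    by apply/cvg_ex; exists l.
  by apply: nearW => m; rewrite -lee_fin.
- exact: leey.
Qed.

Section local_charge.
Context (R : realType) (n : nat).
Implicit Types (s : set 'rV[R]_n -> R) (A B : set 'rV[R]_n).

Lemma locally_sigma_additiveN s : locally_sigma_additive s ->
  locally_sigma_additive (fun A => - s A).
Proof.
move=> sadd F rF tF rUF.
under eq_fun do rewrite sumrN.
exact: (cvgN (sadd F rF tF rUF)).
Qed.

(** The partial sums of the constant family are the multiples of the value at
    [set0]: consecutive ones differ by that value, yet they converge. *)
Lemma locally_sigma_additive0 s : locally_sigma_additive s -> s set0 = 0.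
Proof.
move=> /(_ (fun=> set0)) sadd.
have {}sadd : \sum_(k < m) s set0 @[m --> \oo] --> s set0.
  have U0 : \bigcup_(k in [set: nat]) (set0 : set 'rV[R]_n) = set0.
    exact: bigcup0.
  rewrite U0 in sadd; apply: sadd => [_| |]; [exact: relcompact0| |].
    exact: trivIset_set0.
  exact: relcompact0.
have h1 : \sum_(k < m.+1) s set0 @[m --> \oo] --> s set0.
  by move: sadd; rewrite -(cvg_shiftS (fun m => \sum_(k < m) s set0)).
have : (\sum_(k < m.+1) s set0 - \sum_(k < m) s set0) @[m --> \oo] --> s set0 - s set0.
  exact: cvgB.
under eq_fun do rewrite big_ord_recr/= addrAC subrr add0r.
by move=> /(cvg_unique (@Rhausdorff R)) /(_ (@cvg_cst _ _ _ _ _)) <-; rewrite subrr.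
Qed.

Lemma locally_sigma_additiveU s A B : locally_sigma_additive s ->
  relcompact A -> relcompact B -> A `&` B = set0 ->
  s (A `|` B) = s A + s B.
Proof.
move=> sadd rA rB AB0.
have := sadd (bigcup2 A B).
rewrite bigcup2E => /(_ _ _ (relcompactU rA rB)) H.
have {}H : \sum_(k < m) s (bigcup2 A B k) @[m --> \oo] --> s (A `|` B).
  apply: H; last by rewrite -trivIset_bigcup2.
  by move=> [|[|k]] //=; exact: relcompact0.
apply: (cvg_unique (@Rhausdorff R) H).
apply: cvg_near_cst; near=> m.
have [k ->] : exists k, m = k.+2.
  by exists (m - 2)%N; rewrite -addn2 subnK//; near: m; exact: nbhs_infty_ge.
rewrite 2!big_ord_recl/= addrA [X in _ + X]big1 ?addr0// => i _ /=.
exact: locally_sigma_additive0.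
Unshelve. all: by end_near. Qed.

Lemma upper_variation_ge s A B : relcompact B -> B `<=` A ->
  ((s B)%:E <= upper_variation s A)%E.
Proof. by move=> rB BA; apply: ereal_sup_ubound; exists B. Qed.

Lemma upper_variation_ge0 s A : locally_sigma_additive s ->
  (0 <= upper_variation s A)%E.
Proof.
move=> sadd; rewrite -[0%E]/(0%:E) -(locally_sigma_additive0 sadd).
by apply: upper_variation_ge => //; exact: relcompact0.
Qed.

(** A relatively compact set lies in the orthant, so that only the empty set
    competes. *)
Lemma upper_variation_outside s A : locally_sigma_additive s ->
  A `&` orthant = set0 -> upper_variation s A = 0%E.
Proof.
move=> sadd A0; apply/eqP; rewrite eq_le upper_variation_ge0// andbT.
apply: ge_ereal_sup => _ [B [rB BA] <-].
rewrite (_ : B = set0) ?locally_sigma_additive0//.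
by apply/seteqP; split => // t Bt; rewrite -A0; split; [exact: BA|exact: relcompact_orthant Bt].
Qed.

Lemma upper_variation_semi_sigma_additive s : locally_sigma_additive s ->
  semi_sigma_additive (upper_variation s).
Proof.
move=> sadd; apply: superadditive_semi_sigma_additive.
- by rewrite upper_variation_outside// set0I.
- by move=> A; exact: upper_variation_ge0.
- move=> A B mA mB AB0.
  have in0 C : [set (s D)%:E | D in [set D | relcompact D /\ D `<=` C]] 0%E.
    exists set0; first by split => //; exact: relcompact0.
    by rewrite locally_sigma_additive0.
  apply: ereal_supD_le => // [_ [C _ <-]//|_ _ [C [rC CA] <-] [D [rD DB] <-]].
  rewrite -EFinD -locally_sigma_additiveU//.
    by apply: upper_variation_ge; [exact: relcompactU|exact: setUSS].
  by apply/seteqP; split => //; rewrite -AB0; exact: setISS.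
- move=> F mF tF; apply: ge_ereal_sup => _ [B [rB BF] <-].
  have BE : B = \bigcup_k (B `&` F k) by rewrite -setI_bigcupr; apply/esym/setIidl.
  have rBF k : relcompact (B `&` F k).
    apply: (relcompact_sub _ _ rB) => //; apply: measurableI => //.
    exact: relcompact_measurable.
  have : \sum_(k < m) s (B `&` F k) @[m --> \oo] --> s B.
    by rewrite [in X in _ --> X]BE; apply: sadd; rewrite -?BE//; exact: trivIset_setIl.
  move=> /cvg_EFin_le; apply => m.
  apply: (@le_trans _ _ (\sum_(0 <= k < m) upper_variation s (F k))%E); last first.
    by apply: nneseries_lim_ge => k _ _; exact: upper_variation_ge0.
  rewrite -sumEFin big_mkord; apply: lee_sum => k _.
  exact: upper_variation_ge.
Qed.

Lemma upper_variation_measure s : locally_sigma_additive s ->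
  (forall A, relcompact A -> (upper_variation s A < +oo)%E) ->
  exists P : {sigma_finite_measure set 'rV[R]_n -> \bar R},
    P = upper_variation s :> (set 'rV[R]_n -> \bar R).
Proof.
move=> sadd sfin; apply: exists_sigma_finite_measure.
- by rewrite upper_variation_outside// set0I.
- by move=> A; exact: upper_variation_ge0.
- exact: upper_variation_semi_sigma_additive.
- by apply: sigma_finite_orthant => //; rewrite upper_variation_outside// setICl.
Qed.

(** The Jordan decomposition on relatively compact sets: the complement in [A]
    of a competitor for the upper variation of [s] is a competitor for that of
    [- s]. *)
Lemma upper_variationB s A : locally_sigma_additive s -> relcompact A ->
  upper_variation s A = ((s A)%:E + upper_variation (fun B => - s B)%R A)%E.
Proof.
move=> sadd rA; have sNadd := locally_sigma_additiveN sadd.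
have le t : locally_sigma_additive t ->
    (upper_variation t A <= (t A)%:E + upper_variation (fun B => - t B)%R A)%E.
  move=> tadd; apply: ge_ereal_sup => _ [B [rB BA] <-].
  have rAB : relcompact (A `\` B).
    apply: (relcompact_sub _ _ rA) => //; apply: measurableD;
      exact: relcompact_measurable.
  have -> : t B = t A - t (A `\` B).
    apply/eqP; rewrite eq_sym subr_eq -locally_sigma_additiveU//.
      by rewrite setDUK.
    by rewrite setDIK.
  by rewrite EFinB leeD2l//; apply: upper_variation_ge => //; exact: subDsetl.
apply/eqP; rewrite eq_le le//=.
have := le _ sNadd.
rewrite (_ : (fun B => - - s B) = s); last by apply/funext => B; rewrite opprK.
by move=> /(leeD2l (s A)%:E) /le_trans; apply; rewrite addeA -EFinD subrr add0e.
Qed.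

End local_charge.

(** * The total variation *)

Section total_variation.
Context (R : realType) (n : nat) (mu : complex_radon R n).
Implicit Types (s : set 'rV[R]_n -> R) (A B : set 'rV[R]_n).

Let re B := complex.Re (radon_val mu B).
Let im B := complex.Im (radon_val mu B).

Lemma locally_sigma_additive_Re : locally_sigma_additive re.
Proof.
move=> F rF tF rUF; have /cvg_complexP[+ _] := @radon_sigma_additive _ _ mu _ rF tF rUF.
by under eq_fun do rewrite raddf_sum.
Qed.

Lemma locally_sigma_additive_Im : locally_sigma_additive im.
Proof.
move=> F rF tF rUF; have /cvg_complexP[_] := @radon_sigma_additive _ _ mu _ rF tF rUF.
by under eq_fun do rewrite raddf_sum.
Qed.

Lemma radon_val0 : radon_val mu set0 = 0.
Proof.
have := locally_sigma_additive0 locally_sigma_additive_Re.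
have := locally_sigma_additive0 locally_sigma_additive_Im.
by rewrite /re /im; case: radon_val => ? ? /= -> ->.
Qed.

Lemma radon_variation_ge (m : nat) (F : nat -> set 'rV[R]_n) A :
  (forall k, (k < m)%N -> relcompact (F k) /\ F k `<=` A) -> trivIset `I_m F ->
  ((\sum_(k < m) Normc.normc (radon_val mu (F k)))%:E <= radon_variation mu A)%E.
Proof. by move=> FA tF; apply: ereal_sup_ubound; exists m, F. Qed.

Lemma radon_variation_ge1 A B : relcompact A -> A `<=` B ->
  ((Normc.normc (radon_val mu A))%:E <= radon_variation mu B)%E.
Proof.
move=> rA AB; have := @radon_variation_ge 1 (fun=> A) B.
by rewrite big_ord1; apply=> // -[|?] [|?].
Qed.

Lemma radon_variation_ge0 A : (0 <= radon_variation mu A)%E.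
Proof.
have := @radon_variation_ge 0 (fun=> set0) A.
by rewrite big_ord0; apply=> // -[].
Qed.

Lemma radon_variation_outside A : A `&` orthant = set0 ->
  radon_variation mu A = 0%E.
Proof.
move=> A0; apply/eqP; rewrite eq_le radon_variation_ge0 andbT.
apply: ge_ereal_sup => _ [m [F [FA _ ->]]].
rewrite big1// => k _; have [rF FkA] := FA k (ltn_ord k).
rewrite (_ : F k = set0) ?radon_val0 ?Normc.normc0//.
apply/seteqP; split => // t Ft; rewrite -A0.
by split; [exact: FkA|exact: relcompact_orthant Ft].
Qed.

Lemma radon_variation_lty A : relcompact A -> (radon_variation mu A < +oo)%E.
Proof.
move=> [mA [K [cK KO AK]]].
apply: le_lt_trans (radon_locally_finite mu cK KO).
apply: ge_ereal_sup => _ [m [F [FA tF ->]]]; apply: radon_variation_ge => //.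
by move=> k /FA[? FkA]; split => //; exact: subset_trans AK.
Qed.

Lemma radon_variation_superadditive A B : A `&` B = set0 ->
  (radon_variation mu A + radon_variation mu B <= radon_variation mu (A `|` B))%E.
Proof.
move=> AB0.
have in0 C : [set y | exists (m : nat) (F : nat -> set 'rV[R]_n),
    [/\ forall k, (k < m)%N -> relcompact (F k) /\ F k `<=` C,
        trivIset `I_m F &
        y = (\sum_(k < m) Normc.normc (radon_val mu (F k)))%:E]] 0%E.
  by exists 0%N, (fun=> set0); rewrite big_ord0.
apply: ereal_supD_le => //; first by move=> _ [m [F [_ _ ->]]].
move=> _ _ [p [F [FA tF ->]]] [q [G [GB tG ->]]].
(* The concatenation of the two finite families. *)
pose H k := if (k < p)%N then F k else G (k - p)%N.
rewrite -EFinD (_ : _ + _ = \sum_(k < p + q) Normc.normc (radon_val mu (H k))).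
  apply: radon_variation_ge => [k kpq|].
    rewrite /H; case: ltnP => kp.
      by have [? ?] := FA _ kp; split => //; exact: subset_trans (@subsetUl _ _ _).
    have [|? ?] := GB (k - p)%N; first by rewrite ltn_subLR.
    by split => //; exact: subset_trans (@subsetUr _ _ _).
  have FG0 i j : (i < p)%N -> (j < q)%N -> F i `&` G j = set0.
    move=> ip jq; apply/seteqP; split => //; rewrite -AB0; apply: setISS.
      exact: (FA _ ip).2.
    exact: (GB _ jq).2.
  move/trivIsetP : tF => tF; move/trivIsetP : tG => tG.
  apply/trivIsetP => i j /= ipq jpq ij; rewrite /H.
  case: ltnP => ip; case: ltnP => jp.
  - exact: tF.
  - by apply: FG0 => //; rewrite ltn_subLR.
  - by rewrite setIC; apply: FG0 => //; rewrite ltn_subLR.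
  - apply: tG; rewrite /= ?ltn_subLR//.
    by apply: contra ij => /eqP h; rewrite -(subnK ip) -(subnK jp) h.
rewrite big_split_ord/=; congr (_ + _); apply: eq_bigr => i _.
  by rewrite /H ltn_ord.
by rewrite /H ltnNge leq_addr/= addKn.
Qed.

(** Countable subadditivity of the modulus; it passes to the total variation
    by exchanging a finite sum with a series of nonnegative terms. *)
Lemma normc_radon_val_le A (F : nat -> set 'rV[R]_n) : relcompact A ->
  (forall k, measurable (F k)) -> trivIset setT F -> A `<=` \bigcup_k F k ->
  ((Normc.normc (radon_val mu A))%:E <=
     \sum_(0 <= i <oo) (Normc.normc (radon_val mu (A `&` F i)))%:E)%E.
Proof.
move=> rA mF tF AF.
have AE : A = \bigcup_k (A `&` F k) by rewrite -setI_bigcupr; apply/esym/setIidl.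
have rAF k : relcompact (A `&` F k).
  apply: (relcompact_sub _ _ rA) => //; apply: measurableI => //.
  exact: relcompact_measurable.
have : \sum_(k < m) radon_val mu (A `&` F k) @[m --> \oo] --> radon_val mu A.
  rewrite [in X in _ --> X]AE; apply: (@radon_sigma_additive _ _ mu); rewrite -?AE//.
  exact: trivIset_setIl.
move=> /cvg_normc /cvg_EFin_le; apply => m.
apply: (@le_trans _ _ (\sum_(0 <= k < m)
    (Normc.normc (radon_val mu (A `&` F k)))%:E)%E); last first.
  by apply: nneseries_lim_ge => k _ _; rewrite lee_fin; exact: normc_ge0.
rewrite sumEFin big_mkord lee_fin.
elim: m => [|m IH]; first by rewrite !big_ord0 Normc.normc0.
rewrite !big_ord_recr/=; apply: le_trans (le_normcD _ _) _.
by rewrite lerD2r.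
Qed.

Lemma radon_variation_measure :
  exists V : {sigma_finite_measure set 'rV[R]_n -> \bar R},
    V = radon_variation mu :> (set 'rV[R]_n -> \bar R).
Proof.
apply: exists_sigma_finite_measure.
- by rewrite radon_variation_outside// set0I.
- by move=> A; exact: radon_variation_ge0.
- apply: superadditive_semi_sigma_additive.
  + by rewrite radon_variation_outside// set0I.
  + by move=> A; exact: radon_variation_ge0.
  + by move=> A B _ _; exact: radon_variation_superadditive.
  + move=> F mF tF; apply: ge_ereal_sup => _ [m [G [GF tG ->]]].
    rewrite -sumEFin -(big_mkord predT (fun k => (Normc.normc (radon_val mu (G k)))%:E)).
    apply: (@le_trans _ _ (\sum_(0 <= k < m) \sum_(0 <= i <oo)
        (Normc.normc (radon_val mu (G k `&` F i)))%:E)%E).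
      rewrite !big_mkord; apply: lee_sum => k _.
      by have [? ?] := GF k (ltn_ord k); exact: normc_radon_val_le.
    rewrite -nneseries_sum_nat; last by move=> i j; rewrite lee_fin normc_ge0.
    apply: lee_nneseries => [i _ _|i _].
      by apply: sume_ge0 => k _; rewrite lee_fin normc_ge0.
    rewrite big_mkord sumEFin.
    apply: (@radon_variation_ge m (fun k => G k `&` F i)) => [k km|].
      have [rG _] := GF k km; split; last exact: subIsetr.
      apply: (relcompact_sub _ _ rG) => //; apply: measurableI => //.
      exact: relcompact_measurable.
    exact: trivIset_setIr.
- apply: sigma_finite_orthant; last exact: radon_variation_lty.
  by rewrite radon_variation_outside// setICl.
Qed.

Lemma upper_variation_le_radon_variation s A :
  (forall B, s B <= Normc.normc (radon_val mu B)) ->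
  (upper_variation s A <= radon_variation mu A)%E.
Proof.
move=> smu; apply: ge_ereal_sup => _ [B [rB BA] <-].
by apply: le_trans (radon_variation_ge1 rB BA); rewrite lee_fin.
Qed.

End total_variation.

(** * From measure inequalities to integral inequalities *)

Section dominance.
Context (R : realType) (n : nat).

(** The left-hand side is continuous along the exhaustion by cubes and does not
    charge the complement of the orthant. *)
Lemma le_measure_relcompact (m1 m2 : {measure set 'rV[R]_n -> \bar R}) :
  m1 (~` orthant) = 0%E ->
  (forall A, relcompact A -> (m1 A <= m2 A)%E) ->
  forall A, measurable A -> (m1 A <= m2 A)%E.
Proof.
move=> m10 m12 A mA.
have rAc j : relcompact (A `&` @cube R n j).
  apply: (relcompact_sub _ _ (relcompact_cube j)) => //.
  by apply: measurableI => //; exact: relcompact_measurable (relcompact_cube j).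
have AE : A = \bigcup_j (A `&` @cube R n j) `|` (A `&` ~` orthant).
  by rewrite -setI_bigcupr bigcup_cube -setIUr setUv setIT.
have mU : measurable (\bigcup_j (A `&` @cube R n j)).
  by apply: bigcup_measurable => j _; exact: relcompact_measurable.
have mC : measurable (A `&` ~` orthant).
  by apply: measurableI => //; apply: measurableC; exact: measurable_orthant.
have mC0 : m1 (A `&` ~` orthant) = 0%E.
  apply: (subset_measure0 _ _ _ m10) => //.
  by apply: measurableC; exact: measurable_orthant.
have -> : m1 A = m1 (\bigcup_j (A `&` @cube R n j)).
  have disj : \bigcup_j (A `&` @cube R n j) `&` (A `&` ~` orthant) = set0.
    rewrite -setI_bigcupr bigcup_cube; apply/seteqP; split => // t.
    by move=> -[[_ tO] [_]].
  transitivity (m1 (\bigcup_j (A `&` @cube R n j)) + m1 (A `&` ~` orthant))%E.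
    by rewrite -measureU// -AE.
  by rewrite mC0 adde0.
have cv : m1 (A `&` @cube R n j) @[j --> \oo] --> m1 (\bigcup_j (A `&` @cube R n j)).
  apply: nondecreasing_cvg_mu => //.
    by move=> j; exact: relcompact_measurable.
  move=> i j ij; apply/subsetPset; apply: setIS.
  by apply/subsetPset; exact: nondecreasing_cube.
rewrite -(cvg_lim (@ereal_hausdorff R) cv); apply: lime_le.
  by apply/cvg_ex; eexists; exact: cv.
apply: nearW => j; apply: le_trans (m12 _ (rAc j)) _.
by apply: le_measure; rewrite ?inE//; exact: relcompact_measurable.
Qed.

Local Notation "I_[ P ] k" := (\int[P]_(t in orthant) (k t)%:E)%E
  (at level 10, P at level 200, k at level 9).

(** For a nonnegative combination dominated by the modulus, moving the terms
    with a minus sign to the other side turns the inequality between integrals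
    into an inequality between positive measures. *)
Lemma le_integral_jordan (mu : complex_radon R n) (s s' : set 'rV[R]_n -> R)
    (a b : R) (k : 'rV[R]_n -> R)
    (V P N P' N' : {sigma_finite_measure set 'rV[R]_n -> \bar R}) :
  locally_sigma_additive s -> locally_sigma_additive s' ->
  0 <= a -> 0 <= b ->
  (forall B, - s B <= Normc.normc (radon_val mu B)) ->
  (forall B, - s' B <= Normc.normc (radon_val mu B)) ->
  (forall B, a * s B + b * s' B <= Normc.normc (radon_val mu B)) ->
  V = radon_variation mu :> (set 'rV[R]_n -> \bar R) ->
  P = upper_variation s :> (set 'rV[R]_n -> \bar R) ->
  N = upper_variation (fun B => - s B) :> (set 'rV[R]_n -> \bar R) ->
  P' = upper_variation s' :> (set 'rV[R]_n -> \bar R) ->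
  N' = upper_variation (fun B => - s' B) :> (set 'rV[R]_n -> \bar R) ->
  (forall t, 0 <= k t) -> measurable_fun setT k ->
  (a%:E * I_[P] k + b%:E * I_[P'] k <=
     I_[V] k + (a%:E * I_[N] k + b%:E * I_[N'] k))%E.
Proof.
move=> sadd sadd' a0 b0 smu smu' absmu VE PE NE PE' NE' k0 mk.
pose m1 := measure_add (mscale (NngNum a0) P) (mscale (NngNum b0) P').
pose m2 := measure_add V
  (measure_add (mscale (NngNum a0) N) (mscale (NngNum b0) N')).
have m1E A : m1 A = (a%:E * P A + b%:E * P' A)%E.
  by rewrite /m1 measure_addE.
have m2E A : m2 A = (V A + (a%:E * N A + b%:E * N' A))%E.
  rewrite /m2 measure_addE; congr (_ + _)%E; exact: measure_addE.
have mO := @measurable_orthant R n.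
have mEk : measurable_fun [set: 'rV[R]_n] (fun t => (k t)%:E) by exact/measurable_EFinP.
have mEkO : measurable_fun (@orthant R n) (fun t => (k t)%:E).
  exact: measurable_funS mEk.
have kO0 (t : 'rV[R]_n) : orthant t -> (0 <= (k t)%:E)%E.
  by move=> _; rewrite lee_fin.
have : (I_[m1] k <= I_[m2] k)%E.
  apply: (ge0_le_measure_integral _ mO _ mEk); last first.
    by move=> t; rewrite lee_fin.
  apply: le_measure_relcompact => [|A rA].
    rewrite -[LHS]/(m1 _) m1E PE PE'.
    by rewrite !upper_variation_outside ?setICl// !mule0 adde0.
  rewrite -[leLHS]/(m1 A) -[leRHS]/(m2 A) m1E m2E VE PE NE PE' NE'.
  have NA t : locally_sigma_additive t ->
      (forall B, - t B <= Normc.normc (radon_val mu B)) ->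
      upper_variation (fun B => - t B) A \is a fin_num.
    move=> tadd tmu; rewrite ge0_fin_numE; last first.
      by apply: upper_variation_ge0; exact: locally_sigma_additiveN.
    apply: le_lt_trans (radon_variation_lty mu rA).
    exact: upper_variation_le_radon_variation.
  rewrite (upper_variationB sadd rA) (upper_variationB sadd' rA).
  rewrite -(fineK (NA s _ _))// -(fineK (NA s' _ _))//.
  apply: (@le_trans _ _ ((Normc.normc (radon_val mu A))%:E + _)%E); last first.
    by apply: leeD2r; exact: radon_variation_ge1.
  rewrite -!EFinD lee_fin.
  have := absmu A; set x := fine _; set y := fine _; lra.
rewrite /m1 /m2 !ge0_integral_measure_add//.
by rewrite !ge0_integral_mscale.
Qed.

End dominance.

(** * The Jordan parts of a complex Radon measure *)

Lemma integrable_le_measure d (T : measurableType d) (R : realType)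
    (m1 m2 : {measure set T -> \bar R}) (D : set T) (f : T -> R) :
  (forall A, measurable A -> (m1 A <= m2 A)%E) ->
  measurable D -> measurable_fun setT f ->
  m2.-integrable D (EFin \o f) -> m1.-integrable D (EFin \o f).
Proof.
move=> m12 mD mf /integrableP[mfD foo].
apply/integrableP; split => //; apply: le_lt_trans foo.
apply: (ge0_le_measure_integral m12 mD) => //.
by apply: measurableT_comp => //; exact/measurable_EFinP.
Qed.

(** Cauchy-Schwarz: the modulus is the supremum of the linear forms of norm at
    most [1]. *)
Lemma le_normc_dual (R : realType) (a b : R) (z : R[i]) : a ^+ 2 + b ^+ 2 <= 1 ->
  a * complex.Re z + b * complex.Im z <= Normc.normc z.
Proof.
move=> ab; case: z => x y /=; apply: le_trans (ler_norm _) _.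
rewrite -sqrtr_sqr ler_wsqrtr//.
have : 0 <= (a * y - b * x) ^+ 2 by exact: sqr_ge0.
have : (a ^+ 2 + b ^+ 2) * (x ^+ 2 + y ^+ 2) <= x ^+ 2 + y ^+ 2.
  by rewrite ler_piMl// addr_ge0// sqr_ge0.
nra.
Qed.

Section radon_jordan.
Context (R : realType) (n : nat) (mu : complex_radon R n).

Let re B := complex.Re (radon_val mu B).
Let im B := complex.Im (radon_val mu B).

Let variation_measure s : locally_sigma_additive s ->
  (forall B, `|s B| <= Normc.normc (radon_val mu B)) ->
  exists P : {sigma_finite_measure set 'rV[R]_n -> \bar R},
    P = upper_variation s :> (set 'rV[R]_n -> \bar R).
Proof.
move=> sadd smu; apply: upper_variation_measure => // A rA.
apply: le_lt_trans (radon_variation_lty mu rA).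
by apply: upper_variation_le_radon_variation => B; exact: le_trans (ler_norm _) _.
Qed.

(** The four Jordan parts are genuine measures, and the modulus of the integral
    against the complex measure is bounded through the total variation: for
    the unit vector [(a, b)] in the direction of the integral, the
    inequality of [le_integral_jordan] is applied to the positive and the
    negative part of the integrand. *)
Lemma radon_jordan :
  exists V P N P' N' : {sigma_finite_measure set 'rV[R]_n -> \bar R},
  [/\ V = radon_variation mu :> (set 'rV[R]_n -> \bar R),
      (forall k, radon_integral mu k =
        ((\int[P]_(t in orthant) k t - \int[N]_(t in orthant) k t) +i*
         (\int[P']_(t in orthant) k t - \int[N']_(t in orthant) k t))%C),
      (forall A, measurable A ->
        [/\ (P A <= V A)%E, (N A <= V A)%E, (P' A <= V A)%E & (N' A <= V A)%E]) &
      (forall k, measurable_fun setT k -> V.-integrable orthant (EFin \o k) ->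
        Normc.normc (radon_integral mu k) <= \int[V]_(t in orthant) `|k t|)].
Proof.
have radd := @locally_sigma_additive_Re _ _ mu; have iadd := @locally_sigma_additive_Im _ _ mu.
have rmu B : `|re B| <= Normc.normc (radon_val mu B) by exact: normr_Re_le.
have imu B : `|im B| <= Normc.normc (radon_val mu B) by exact: normr_Im_le.
have rNmu B : `|- re B| <= Normc.normc (radon_val mu B) by rewrite normrN.
have iNmu B : `|- im B| <= Normc.normc (radon_val mu B) by rewrite normrN.
have rNadd := locally_sigma_additiveN radd; have iNadd := locally_sigma_additiveN iadd.
have [V VE] := radon_variation_measure mu.
have [P PE] := variation_measure radd rmu.
have [N NE] := variation_measure rNadd rNmu.
have [P' PE'] := variation_measure iadd imu.
have [N' NE'] := variation_measure iNadd iNmu.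
have intE k : radon_integral mu k =
    ((\int[P]_(t in orthant) k t - \int[N]_(t in orthant) k t) +i*
     (\int[P']_(t in orthant) k t - \int[N']_(t in orthant) k t))%C.
  rewrite /radon_integral /Rintegral; congr (_ +i* _)%C; congr (_ - _).
  - by rewrite -PE.
  - by rewrite -NE.
  - by rewrite -PE'.
  - by rewrite -NE'.
have leV A : [/\ (P A <= V A)%E, (N A <= V A)%E, (P' A <= V A)%E & (N' A <= V A)%E].
  rewrite VE PE NE PE' NE'.
  by split; apply: upper_variation_le_radon_variation => B;
    apply: le_trans (ler_norm _) _;
    [exact: rmu|exact: rNmu|exact: imu|exact: iNmu].
have mO := @measurable_orthant R n.
exists V, P, N, P', N'; split => // k mk ik.
have mkp : measurable_fun setT k^\+ by exact: measurable_funrpos.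
have mkn : measurable_fun setT k^\- by exact: measurable_funrneg.
have ikp : V.-integrable orthant (EFin \o k^\+) by exact: integrable_funrpos.
have ikn : V.-integrable orthant (EFin \o k^\-) by exact: integrable_funrneg.
have PV A : measurable A -> (P A <= V A)%E by case: (leV A).
have NV A : measurable A -> (N A <= V A)%E by case: (leV A).
have PV' A : measurable A -> (P' A <= V A)%E by case: (leV A).
have NV' A : measurable A -> (N' A <= V A)%E by case: (leV A).
have J a b (h : 'rV[R]_n -> R) : a ^+ 2 + b ^+ 2 <= 1 ->
    (forall t, 0 <= h t) -> measurable_fun setT h ->
    V.-integrable orthant (EFin \o h) ->
    a * (\int[P]_(t in orthant) h t - \int[N]_(t in orthant) h t) +
    b * (\int[P']_(t in orthant) h t - \int[N']_(t in orthant) h t) <=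
    \int[V]_(t in orthant) h t.
  move=> ab h0 mh ih.
  have fin (m : {measure set 'rV[R]_n -> \bar R}) :
      (forall A, measurable A -> (m A <= V A)%E) ->
      (\int[m]_(t in orthant) (h t)%:E)%E = (\int[m]_(t in orthant) h t)%:E.
    move=> mV; rewrite fineK//; apply: integrable_fin_num => //.
    exact: integrable_le_measure ih.
  have NN (s : set 'rV[R]_n -> R) : (fun B => - - s B) = s.
    by apply/funext => B; rewrite opprK.
  have dual B := le_normc_dual (radon_val mu B) ab.
  have le_re B := le_trans (ler_norm _) (rmu B).
  have le_im B := le_trans (ler_norm _) (imu B).
  have le_reN B := le_trans (ler_norm _) (rNmu B).
  have le_imN B := le_trans (ler_norm _) (iNmu B).
  (* A negative coefficient is absorbed by replacing the set function with its
     opposite, which exchanges the two Jordan parts. *)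
  have [a0|/ltW] := leP 0 a; last rewrite -oppr_ge0 => a0;
    (have [b0|/ltW] := leP 0 b; last rewrite -oppr_ge0 => b0).
  - have := @le_integral_jordan _ _ mu re im a b h V P N P' N' radd iadd a0 b0.
    rewrite !fin// -!EFinD lee_fin => /(_ le_reN le_imN dual VE PE NE PE' NE' h0 mh).
    lra.
  - have := @le_integral_jordan _ _ mu re (fun B => - im B) a (- b) h V P N N' P'
      radd iNadd a0 b0.
    rewrite !fin// -!EFinD lee_fin NN.
    have dual' B : a * re B + - b * - im B <= Normc.normc (radon_val mu B).
      by rewrite mulrNN; exact: dual.
    have le_imNN B : - - im B <= Normc.normc (radon_val mu B).
      by rewrite opprK.
    move=> /(_ le_reN le_imNN dual' VE PE NE NE' PE' h0 mh); lra.
  - have := @le_integral_jordan _ _ mu (fun B => - re B) im (- a) b h V N P P' N'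
      rNadd iadd a0 b0.
    rewrite !fin// -!EFinD lee_fin NN.
    have dual' B : - a * - re B + b * im B <= Normc.normc (radon_val mu B).
      by rewrite mulrNN; exact: dual.
    have le_reNN B : - - re B <= Normc.normc (radon_val mu B).
      by rewrite opprK.
    move=> /(_ le_reNN le_imN dual' VE NE PE PE' NE' h0 mh); lra.
  - have := @le_integral_jordan _ _ mu (fun B => - re B) (fun B => - im B)
      (- a) (- b) h V N P N' P' rNadd iNadd a0 b0.
    rewrite !fin// -!EFinD lee_fin !NN.
    have dual' B : - a * - re B + - b * - im B <= Normc.normc (radon_val mu B).
      by rewrite !mulrNN; exact: dual.
    have le_reNN B : - - re B <= Normc.normc (radon_val mu B).
      by rewrite opprK.
    have le_imNN B : - - im B <= Normc.normc (radon_val mu B).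
      by rewrite opprK.
    move=> /(_ le_reNN le_imNN dual' VE NE PE NE' PE' h0 mh); lra.
have split_ (m : {measure set 'rV[R]_n -> \bar R}) :
    (forall A, measurable A -> (m A <= V A)%E) ->
    \int[m]_(t in orthant) k t =
    \int[m]_(t in orthant) k^\+ t - \int[m]_(t in orthant) k^\- t.
  move=> mV; rewrite -RintegralB//; last 2 first.
  - exact: integrable_le_measure ikp.
  - exact: integrable_le_measure ikn.
  by apply: eq_Rintegral => t _; rewrite -[in LHS](funrposBneg k).
have -> : \int[V]_(t in orthant) `|k t| =
    \int[V]_(t in orthant) k^\+ t + \int[V]_(t in orthant) k^\- t.
  rewrite -RintegralD//; apply: eq_Rintegral => t _.
  by have /(congr1 (fun f => f t)) := funrposDneg k.
rewrite intE !split_//.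
have kp0 t : 0 <= k^\+ t by exact: funrpos_ge0.
have kn0 t : 0 <= k^\- t by exact: funrneg_ge0.
set z := (_ +i* _)%C; set x := complex.Re z; set y := complex.Im z.
have [z0|z0] := eqVneq (Normc.normc z) 0.
  by rewrite z0 addr_ge0//; apply: Rintegral_ge0.
(* The unit vector in the direction of the integral turns its modulus into a
   linear form. *)
pose a := x / Normc.normc z; pose b := y / Normc.normc z.
have zz : Normc.normc z ^+ 2 = x ^+ 2 + y ^+ 2.
  by rewrite /x /y; case: (z) => u v /=; rewrite sqr_sqrtr// addr_ge0// sqr_ge0.
have ab1 : a ^+ 2 + b ^+ 2 <= 1.
  by rewrite /a /b !expr_div_n -mulrDl -zz divff// expf_neq0.
have ab1N : (- a) ^+ 2 + (- b) ^+ 2 <= 1 by rewrite !sqrrN.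
have := lerD (J _ _ _ ab1 kp0 mkp ikp) (J _ _ _ ab1N kn0 mkn ikn).
apply: le_trans.
have -> : Normc.normc z = a * x + b * y.
  by rewrite /a /b mulrAC [y / _ * _]mulrAC -mulrDl -!expr2 -zz expr2 mulfK.
rewrite /x /y /z /=; lra.
Qed.

End radon_jordan.

(** * Lebesgue integrals of tensor products *)

Lemma integrable_Rintegral_tensor d1 d2 (T1 : measurableType d1)
    (T2 : measurableType d2) (R : realType)
    (m1 : {sigma_finite_measure set T1 -> \bar R})
    (m2 : {sigma_finite_measure set T2 -> \bar R}) (f : T1 -> R) (g : T2 -> R) :
  m1.-integrable setT (EFin \o f) -> m2.-integrable setT (EFin \o g) ->
  (m1 \x m2)%E.-integrable setT (EFin \o (fun z => f z.1 * g z.2)) /\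
  \int[(m1 \x m2)%E]_z (f z.1 * g z.2) = \int[m1]_x f x * \int[m2]_y g y.
Proof.
move=> intf intg.
have mf : measurable_fun setT f by exact/measurable_EFinP/(measurable_int _ intf).
have mg : measurable_fun setT g by exact/measurable_EFinP/(measurable_int _ intg).
have mfg : measurable_fun setT (EFin \o (fun z : T1 * T2 => f z.1 * g z.2)).
  by apply/measurable_EFinP; apply: measurable_funM;
    [exact: measurableT_comp mf measurable_fst
    |exact: measurableT_comp mg measurable_snd].
have int_fg : (m1 \x m2)%E.-integrable setT (EFin \o (fun z => f z.1 * g z.2)).
  apply/(integrable12ltyP _ _ mfg) => /=.
  under eq_integral => x _.
    under eq_integral => y _ do rewrite normrM EFinM.
    rewrite ge0_integralZl//; last by do 2 apply: measurableT_comp => //.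
    over.
  rewrite ge0_integralZr//; last 2 first.
  - by do 2 apply: measurableT_comp => //.
  - by apply: integral_ge0 => y _; rewrite lee_fin.
  have /integrableP[_ foo] := intf; have /integrableP[_ goo] := intg.
  by apply: lte_mul_pinfty => //; [exact: integral_ge0|
    rewrite ge0_fin_numE//; exact: integral_ge0].
split => //.
rewrite /Rintegral -(integral12_prod_meas1 int_fg) /fubini_F/=.
under eq_integral => x _.
  under eq_integral => y _ do rewrite EFinM.
  rewrite integralZl//.
  over.
by rewrite -(fineK (integrable_fin_num _ intg))// integralZr// fineM// integrable_fin_num.
Qed.

Section lebesgue_rV_fubini.
Context (R : realType).
Local Notation lambda := (@lebesgue_measure R).

Lemma Rintegral_rV_cons n (h : 'rV[R]_n.+1 -> R) :
  measurable_fun setT h ->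
  (lambda \x @lebesgue_rV R n)%E.-integrable setT (EFin \o (h \o @rV_cons R n)) ->
  (@lebesgue_rV R n.+1).-integrable setT (EFin \o h) /\
  \int[@lebesgue_rV R n.+1]_v h v =
    \int[(lambda \x @lebesgue_rV R n)%E]_z h (rV_cons z).
Proof.
move=> mh ih.
have mc : measurable_fun [set: measurableTypeR R * 'rV[R]_n] (@rV_cons R n).
  exact: (@measurable_rV_cons _ R n).
have mEh : measurable_fun setT (EFin \o h) by exact/measurable_EFinP.
split.
  exact: (integrable_pushforward mc (D := setT) mEh ih measurableT).
rewrite /Rintegral; congr fine.
exact: (integral_pushforward mc (D := setT) mEh ih measurableT).
Qed.

Lemma dot_rV_cons n (x : R) (v : 'rV[R]_n) (xi : 'rV[R]_n.+1) :
  dot (rV_cons (x, v)) xi = x * xi ord0 ord0 + dot v (rV_uncons xi).2.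
Proof.
rewrite /dot big_ord_recl !mxE unlift_none/=; congr (_ + _).
by apply: eq_bigr => i _; rewrite !mxE liftK.
Qed.

Lemma measurable_dot n (xi : 'rV[R]_n) : measurable_fun setT (fun x => dot x xi).
Proof.
apply: measurable_sum => k; apply: measurable_funM => //.
exact: measurable_rV_coord.
Qed.

Definition tensor n (phi : 'I_n -> R -> R) (x : 'rV[R]_n) : R :=
  \prod_k phi k (x ord0 k).

Lemma tensor_rV_cons n (phi : 'I_n.+1 -> R -> R) (x : R) (v : 'rV[R]_n) :
  tensor phi (rV_cons (x, v)) =
  phi ord0 x * tensor (fun k => phi (lift ord0 k)) v.
Proof.
rewrite /tensor big_ord_recl !mxE unlift_none/=; congr (_ * _).
by apply: eq_bigr => i _; rewrite !mxE liftK.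
Qed.

Lemma measurable_tensor n (phi : 'I_n -> R -> R) :
  (forall k, measurable_fun setT (phi k)) -> measurable_fun setT (tensor phi).
Proof.
move=> mphi; apply: measurable_prod => k _.
by apply: (measurableT_comp (mphi k)); exact: measurable_rV_coord.
Qed.

Lemma integrable_bounded_mul d (T : measurableType d)
    (m : {measure set T -> \bar R}) (f b : T -> R) :
  m.-integrable setT (EFin \o f) -> measurable_fun setT b ->
  (forall x, `|b x| <= 1) -> m.-integrable setT (EFin \o (fun x => f x * b x)).
Proof.
move=> intf mb b1; apply: (le_integrable _ _ _ intf) => // [|x _/=].
  apply/measurable_EFinP; apply: measurable_funM => //.
  exact/measurable_EFinP/(measurable_int _ intf).
by rewrite lee_fin normrM ler_piMr.
Qed.

Lemma normr_cos_le (x : R) : `|cos x| <= 1.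
Proof. by rewrite ler_norml cos_geN1 cos_le1. Qed.

Lemma normr_sin_le (x : R) : `|sin x| <= 1.
Proof. by rewrite ler_norml sin_geN1 sin_le1. Qed.

Lemma measurable_cos : measurable_fun setT (@cos R).
Proof. by apply: continuous_measurable_fun; exact: continuous_cos. Qed.

Lemma measurable_sin : measurable_fun setT (@sin R).
Proof. by apply: continuous_measurable_fun; exact: continuous_sin. Qed.

Lemma measurable_cos_dot n (xi : 'rV[R]_n) :
  measurable_fun setT (fun x => cos (dot x xi)).
Proof. exact: measurableT_comp measurable_cos (measurable_dot xi). Qed.

Lemma measurable_sin_dot n (xi : 'rV[R]_n) :
  measurable_fun setT (fun x => sin (dot x xi)).
Proof. exact: measurableT_comp measurable_sin (measurable_dot xi). Qed.

(** The cosine transform of a tensor product factors as soon as the sine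
    transforms of the factors vanish: this is the addition formula, one
    coordinate at a time. *)
Lemma Rintegral_tensor_trig n (phi : 'I_n -> R -> R) (xi : 'rV[R]_n) :
  (forall k, lambda.-integrable setT (EFin \o phi k)) ->
  (forall k, \int[lambda]_x (phi k x * sin (x * xi ord0 k)) = 0) ->
  [/\ (@lebesgue_rV R n).-integrable setT (EFin \o tensor phi),
      \int[@lebesgue_rV R n]_x (tensor phi x * cos (dot x xi)) =
        \prod_k \int[lambda]_x (phi k x * cos (x * xi ord0 k)) &
      \int[@lebesgue_rV R n]_x (tensor phi x * sin (dot x xi)) = 0].
Proof.
elim: n => [|n IH] in phi xi * => iphi sin0.
  have dot0 x : dot x xi = 0 by rewrite /dot big_ord0.
  have mc (c : R) : measurable_fun [set: 'rV[R]_0] (cst c) by [].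
  have I (f : 'rV[R]_0 -> R) (c : R) : f = cst c ->
      (@lebesgue_rV R 0).-integrable setT (EFin \o f) /\
      \int[@lebesgue_rV R 0]_x f x = c.
    have mx : measurable_fun [set: 'rV[R]_0] (EFin \o (cst c : 'rV[R]_0 -> R)).
      exact/measurable_EFinP.
    have oo : (\int[@lebesgue_rV R 0]_x `|(c%:E : \bar R)| = `|c%:E|)%E.
      rewrite (integral_dirac (0 : 'rV[R]_0) measurableT)//.
      by rewrite diracT mul1e.
    move=> ->; split; first by apply/integrableP; split => //=; rewrite oo ltry.
    rewrite /Rintegral (integral_dirac (0 : 'rV[R]_0) measurableT)//.
    by rewrite diracT mul1e.
  have tE : tensor phi = cst 1.
    by apply/funext => x; rewrite /tensor big_ord0.
  have cE : (fun x => tensor phi x * cos (dot x xi)) = cst 1.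
    by apply/funext => x; rewrite tE dot0 cos0 mulr1.
  have sE : (fun x => tensor phi x * sin (dot x xi)) = cst 0.
    by apply/funext => x; rewrite dot0 trigo.sin0 mulr0.
  by rewrite big_ord0 (I _ _ cE).2 (I _ _ sE).2; split => //; exact: (I _ _ tE).1.
have mphi k : measurable_fun setT (phi k).
  by have /measurable_EFinP := measurable_int _ (iphi k).
have mt := measurable_tensor mphi.
have iphi' k := iphi (lift ord0 k).
pose xi' := (rV_uncons xi).2.
have sin0' k : \int[lambda]_x (phi (lift ord0 k) x * sin (x * xi' ord0 k)) = 0.
  by rewrite mxE; exact: sin0.
have [it' cosE' sinE'] := IH _ xi' iphi' sin0'.
have mx0 : measurable_fun setT (fun x : R => x * xi ord0 ord0).
  by apply: measurable_funM.
have mcos0 : measurable_fun setT (fun x : R => cos (x * xi ord0 ord0)).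
  exact: measurableT_comp measurable_cos mx0.
have msin0 : measurable_fun setT (fun x : R => sin (x * xi ord0 ord0)).
  exact: measurableT_comp measurable_sin mx0.
have ic := integrable_bounded_mul (iphi ord0) mcos0 (fun x => normr_cos_le _).
have is_ := integrable_bounded_mul (iphi ord0) msin0 (fun x => normr_sin_le _).
have ic' := integrable_bounded_mul it' (measurable_cos_dot xi') (fun x => normr_cos_le _).
have is' := integrable_bounded_mul it' (measurable_sin_dot xi') (fun x => normr_sin_le _).
have [iccP ccE] := integrable_Rintegral_tensor ic ic'.
have [issP ssE] := integrable_Rintegral_tensor is_ is'.
have [icsP csE] := integrable_Rintegral_tensor ic is'.
have [iscP scE] := integrable_Rintegral_tensor is_ ic'.
have [ittP _] := integrable_Rintegral_tensor (iphi ord0) it'.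
have it : (lambda \x @lebesgue_rV R n)%E.-integrable setT
    (EFin \o (tensor phi \o @rV_cons R n)).
  by apply: eq_integrable ittP => // -[x v] _ /=; rewrite tensor_rV_cons.
split; first exact: (Rintegral_rV_cons mt it).1.
- (* cos (u + v) = cos u cos v - sin u sin v; the second term integrates to a
     product with a vanishing factor. *)
  have mtc := measurable_funM mt (measurable_cos_dot xi).
  have [] := Rintegral_rV_cons mtc.
    apply: eq_integrable (integrableB _ iccP issP) => // -[x v] _ /=.
    by rewrite tensor_rV_cons dot_rV_cons cosD -EFinB; congr EFin; rewrite /xi'; ring.
  have -> : \prod_k \int[lambda]_x (phi k x * cos (x * xi ord0 k)) =
      \int[lambda]_x (phi ord0 x * cos (x * xi ord0 ord0)) *
      \int[@lebesgue_rV R n]_v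
        (tensor (fun k => phi (lift ord0 k)) v * cos (dot v xi')).
    rewrite big_ord_recl cosE'; congr (_ * _); apply: eq_bigr => k _.
    by apply: eq_Rintegral => x _; rewrite mxE.
  move=> _ ->; rewrite -ccE -[RHS]subr0.
  rewrite -(mulr0 (\int[lambda]_x (phi ord0 x * sin (x * xi ord0 ord0)))).
  rewrite -sinE' -ssE -RintegralB//; apply: eq_Rintegral => -[x v] _ /=.
  by rewrite tensor_rV_cons dot_rV_cons cosD /xi'; ring.
- have mts := measurable_funM mt (measurable_sin_dot xi).
  have [] := Rintegral_rV_cons mts.
    apply: eq_integrable (integrableD _ iscP icsP) => // -[x v] _ /=.
    by rewrite tensor_rV_cons dot_rV_cons sinD -EFinD; congr EFin; rewrite /xi'; ring.
  move=> _ ->.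
  transitivity (\int[(lambda \x @lebesgue_rV R n)%E]_z
    (phi ord0 z.1 * sin (z.1 * xi ord0 ord0) *
      (tensor (fun k => phi (lift ord0 k)) z.2 * cos (dot z.2 xi')) +
     phi ord0 z.1 * cos (z.1 * xi ord0 ord0) *
      (tensor (fun k => phi (lift ord0 k)) z.2 * sin (dot z.2 xi')))).
    apply: eq_Rintegral => -[x v] _ /=.
    by rewrite tensor_rV_cons dot_rV_cons sinD /xi'; ring.
  by rewrite RintegralD// scE csE sin0 sinE' mul0r mulr0 addr0.
Qed.

End lebesgue_rV_fubini.

(** * Null sets, reflections and coordinate hyperplanes *)

Section null_sets.
Context (R : realType).
Local Notation lambda := (@lebesgue_measure R).

(** The form in which Fubini's theorem is used for null sets: it allows
    inductions on the dimension. *)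
Lemma lebesgue_rV_null_section n (A : set 'rV[R]_n.+1) : measurable A ->
  @lebesgue_rV R n.+1 A = 0%E <->
  {ae lambda, forall x, @lebesgue_rV R n [set v | A (rV_cons (x, v))] = 0%E}.
Proof.
move=> mA.
pose B : set (measurableTypeR R * 'rV[R]_n) := @rV_cons R n @^-1` A.
have mB : measurable B.
  rewrite -[X in measurable X]setTI.
  by apply: (@measurable_rV_cons _ R n) => //; exact: measurableT.
have sB x : xsection B x = [set v | A (rV_cons (x, v))].
  by apply/seteqP; split => v; rewrite /xsection/= inE.
have -> : @lebesgue_rV R n.+1 A = (\int[lambda]_x `|@lebesgue_rV R n (xsection B x)|)%E.
  rewrite /= /pushforward -/B /product_measure1.
  by apply: eq_integral => x _; rewrite gee0_abs.
have mf : measurable_fun setT (fun x => @lebesgue_rV R n (xsection B x)).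
  exact: measurable_fun_xsection.
have FF := ae_filter_ringOfSetsType lambda.
split.
  move=> /(ae_eq_integral_abs lambda measurableT mf); apply: filterS => x /(_ I).
  by rewrite sB.
move=> H; apply/(ae_eq_integral_abs lambda measurableT mf).
by apply: filterS H => x + _; rewrite sB.
Qed.

Lemma measurable_abs_coord n : measurable_fun setT (@abs_coord R n).
Proof.
apply: measurable_fun_rVP => i.
under [X in measurable_fun _ X]eq_fun do rewrite mxE.
by apply: measurableT_comp => //; exact: measurable_rV_coord.
Qed.

Lemma abs_coord_rV_cons n x (v : 'rV[R]_n) :
  abs_coord (rV_cons (x, v)) = rV_cons (`|x|, abs_coord v).
Proof.
by apply/rowP => i; rewrite !mxE; case: unlift => [j|//]; rewrite mxE.
Qed.

(** Reflections preserve null sets, one coordinate at a time. *)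
Lemma lebesgue_rV_abs_coord_null n (A : set 'rV[R]_n) : measurable A ->
  @lebesgue_rV R n A = 0%E -> @lebesgue_rV R n (@abs_coord R n @^-1` A) = 0%E.
Proof.
elim: n A => [|n IH] A mA A0.
  rewrite (_ : _ @^-1` A = A)//; apply/seteqP; split => v /=;
  by rewrite (_ : abs_coord v = v)//; apply/rowP => -[].
have mabsA : measurable (@abs_coord R n.+1 @^-1` A).
  by rewrite -[X in measurable X]setTI; exact: measurable_abs_coord.
apply/(lebesgue_rV_null_section mabsA).
have [N [mN N0 sN]] := (lebesgue_rV_null_section mA).1 A0.
have mNN : measurable (-%R @^-1` N : set (measurableTypeR R)).
  by rewrite -[X in measurable X]setTI; exact: oppr_measurable.
have NN0 : lambda (-%R @^-1` N) = 0%E by exact: etrans (lebesgue_measureN mN) N0.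
exists (N `|` -%R @^-1` N); split.
- exact: measurableU.
- exact: null_set_setU.
- move=> x /= hx; apply: contrapT => /not_orP[xN xNN]; apply: hx.
  have absN : ~ N `|x|.
    by have [h|h] := leP 0 x; [rewrite ger0_norm|rewrite ltr0_norm].
  have /contrapT h : ~ ~ (@lebesgue_rV R n [set v | A (rV_cons (`|x|, v))] = 0%E).
    by move=> h; apply: absN; exact: sN.
  rewrite (_ : [set v | _] =
    @abs_coord R n @^-1` [set v | A (rV_cons (`|x|, v))]).
    apply: IH => //.
    rewrite (_ : mkset _ = xsection (@rV_cons R n @^-1` A) `|x|).
      apply: measurable_xsection; rewrite -[X in measurable X]setTI.
      exact: measurable_rV_cons.
    by apply/seteqP; split => v; rewrite /xsection/= inE.
  by apply/seteqP; split => v /=; rewrite abs_coord_rV_cons.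
Qed.

Lemma measurable_no_zero_coord n : measurable (@no_zero_coord R n).
Proof.
rewrite (_ : no_zero_coord =
  [set t : 'rV[R]_n | forall i, (~` [set 0]) (t ord0 i)]).
  by apply: (@measurable_coordwise _ _ (fun=> ~` [set 0])) => i; exact: measurableC.
by apply/seteqP; split => t /= tP i; [apply/eqP|apply/eqP]; exact: tP.
Qed.
Arguments measurable_no_zero_coord {n}.

Lemma lebesgue_rV_no_zero_coord n : @lebesgue_rV R n (~` no_zero_coord) = 0%E.
Proof.
elim: n => [|n IH].
  by rewrite (_ : ~` _ = set0) ?measure0//; apply/seteqP; split => // v; apply => -[].
have mC : measurable (~` @no_zero_coord R n.+1).
  by apply: measurableC; exact: measurable_no_zero_coord.
apply/(lebesgue_rV_null_section mC).
exists [set 0]; split => //; first exact: lebesgue_measure_set1.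
move=> x /= hx; apply: contrapT => /eqP x0; apply: hx.
rewrite (_ : [set v | _] = ~` no_zero_coord)//.
apply/seteqP; split => v /= nz h; apply: nz => k.
  by rewrite mxE; case: unlift.
by have := h (lift ord0 k); rewrite mxE liftK.
Qed.

Lemma ae_no_zero_coord n : {ae @lebesgue_rV R n, forall x, no_zero_coord x}.
Proof.
exists (~` no_zero_coord); split => //; last exact: lebesgue_rV_no_zero_coord.
by apply: measurableC; exact: measurable_no_zero_coord.
Qed.

(** The representation of [g] holds almost everywhere on the orthant only; this
    carries it over to the even extension. *)
Lemma ae_abs_coord n (Q : 'rV[R]_n -> Prop) :
  {ae @lebesgue_rV R n, forall x, orthant x -> Q x} ->
  {ae @lebesgue_rV R n, forall x, no_zero_coord x -> Q (abs_coord x)}.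
Proof.
move=> [N [mN N0 sN]]; exists (@abs_coord R n @^-1` N); split.
- by rewrite -[X in measurable X]setTI; exact: measurable_abs_coord.
- exact: lebesgue_rV_abs_coord_null.
- move=> x /= hx; apply: sN => /= h; apply: hx => nz; apply: h => k.
  by rewrite mxE normr_gt0.
Qed.

End null_sets.
Arguments measurable_no_zero_coord {R n}.

(** * Primitives of exponentially damped sines and cosines *)

Section damped_trigonometric_integrals.
Context (R : realType).
Local Notation lambda := (@lebesgue_measure R).

Lemma is_derive_mulr (b x : R) : is_derive x 1 (fun y : R => y * b) b.
Proof.
rewrite (_ : (fun y : R => y * b) = b \*: (@id R)); last first.
  by apply/funext => y; rewrite /= mulrC.
by apply: is_derive_eq; rewrite /GRing.scale/= mulr1.
Qed.

Lemma is_derive_expR_mul (a x : R) :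
  is_derive x 1 (fun y : R => expR (y * a)) (a * expR (x * a)).
Proof.
have h := @is_derive1_comp R expR (fun y => y * a) x _ _
  (is_derive_expR (x * a)) (is_derive_mulr a x).
by apply: is_derive_eq (h) _; rewrite mulrC.
Qed.

Lemma is_derive_cos_mul (b x : R) :
  is_derive x 1 (fun y : R => cos (y * b)) (- (b * sin (x * b))).
Proof.
have h := @is_derive1_comp R cos (fun y => y * b) x _ _
  (is_derive_cos (x * b)) (is_derive_mulr b x).
by apply: is_derive_eq (h) _; rewrite mulNr mulrC.
Qed.

Lemma is_derive_sin_mul (b x : R) :
  is_derive x 1 (fun y : R => sin (y * b)) (b * cos (x * b)).
Proof.
have h := @is_derive1_comp R sin (fun y => y * b) x _ _
  (is_derive_sin (x * b)) (is_derive_mulr b x).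
by apply: is_derive_eq (h) _; rewrite mulrC.
Qed.

Lemma continuous_is_derive (F f : R -> R) :
  (forall x : R, is_derive x 1 F (f x)) -> continuous F.
Proof.
move=> dF x; apply: differentiable_continuous; apply/derivable1_diffP.
by have [] := dF x.
Qed.

Lemma continuous_FTC2_everywhere (F f : R -> R) (a b : R) : a < b ->
  continuous f -> (forall x : R, is_derive x 1 F (f x)) ->
  \int[lambda]_(x in `[a, b]) f x = F b - F a.
Proof.
move=> ab cf dF; rewrite /Rintegral.
have cF := continuous_is_derive dF.
rewrite (@continuous_FTC2 R f F a b)//.
- exact: continuous_subspaceT.
- split=> [x _||].
  + by have [] := dF x.
  + by apply: cvg_at_right_filter; exact: cF.
  + by apply: cvg_at_left_filter; exact: cF.
- by move=> x _; rewrite derive1E derive_val.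
Qed.

Variables (a b : R).
Hypothesis ab0 : a ^+ 2 + b ^+ 2 != 0.

(** Real and imaginary parts of the primitive [exp ((a + i b) x) / (a + i b)] of
    [exp ((a + i b) x)]. *)
Definition exp_cos_primitive (x : R) :=
  expR (x * a) * (a * cos (x * b) + b * sin (x * b)) / (a ^+ 2 + b ^+ 2).
Definition exp_sin_primitive (x : R) :=
  expR (x * a) * (a * sin (x * b) - b * cos (x * b)) / (a ^+ 2 + b ^+ 2).

Lemma is_derive_exp_cos_primitive (x : R) :
  is_derive x 1 exp_cos_primitive (expR (x * a) * cos (x * b)).
Proof.
have de := is_derive_expR_mul a x; have dc := is_derive_cos_mul b x.
have ds := is_derive_sin_mul b x.
have h := is_deriveZ (a ^+ 2 + b ^+ 2)^-1
  (is_deriveM de (is_deriveD (is_deriveZ a dc) (is_deriveZ b ds))).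
rewrite (_ : exp_cos_primitive = (a ^+ 2 + b ^+ 2)^-1 \*:
   ((fun y : R => expR (y * a)) *
   (a \*: (fun y : R => cos (y * b)) + b \*: (fun y : R => sin (y * b))))).
  apply: is_derive_eq (h) _; rewrite /GRing.scale/=.
  by rewrite !fctE/= -![_ *: _]/(_ * _); field.
by apply/funext => y; rewrite /exp_cos_primitive !fctE/= mulrC.
Qed.

Lemma is_derive_exp_sin_primitive (x : R) :
  is_derive x 1 exp_sin_primitive (expR (x * a) * sin (x * b)).
Proof.
have de := is_derive_expR_mul a x; have dc := is_derive_cos_mul b x.
have ds := is_derive_sin_mul b x.
have h := is_deriveZ (a ^+ 2 + b ^+ 2)^-1
  (is_deriveM de (is_deriveB (is_deriveZ a ds) (is_deriveZ b dc))).
rewrite (_ : exp_sin_primitive = (a ^+ 2 + b ^+ 2)^-1 \*: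
   ((fun y : R => expR (y * a)) *
   (a \*: (fun y : R => sin (y * b)) - b \*: (fun y : R => cos (y * b))))).
  apply: is_derive_eq (h) _; rewrite /GRing.scale/=.
  by rewrite !fctE/= -![_ *: _]/(_ * _); field.
by apply/funext => y; rewrite /exp_sin_primitive !fctE/= mulrC.
Qed.

Lemma continuous_exp_cos : continuous (fun x : R => expR (x * a) * cos (x * b)).
Proof.
by move=> x; apply: cvgM; [exact: (continuous_is_derive (is_derive_expR_mul a))
  |exact: (continuous_is_derive (is_derive_cos_mul b))].
Qed.

Lemma continuous_exp_sin : continuous (fun x : R => expR (x * a) * sin (x * b)).
Proof.
by move=> x; apply: cvgM; [exact: (continuous_is_derive (is_derive_expR_mul a))
  |exact: (continuous_is_derive (is_derive_sin_mul b))].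
Qed.

End damped_trigonometric_integrals.

(** * The Fourier transform of a damped window *)

Section abel_kernel.
Context (R : realType).
Local Notation lambda := (@lebesgue_measure R).
Implicit Types (t e b x : R).

Definition damped_window t e x : R := \1_(`[- t, t]%classic) x * expR (- (e * `|x|)).

(** The closed form of [int_{-t}^t exp (- e |x|) cos (x b) dx]. *)
Definition abel_kernel e b t : R :=
  2 * (e + expR (- (t * e)) * (b * sin (t * b) - e * cos (t * b))) /
  (e ^+ 2 + b ^+ 2).

Lemma integrable_damped_window t e : 0 <= e ->
  lambda.-integrable setT (EFin \o damped_window t e).
Proof.
move=> e0; apply: integrable_bounded_mul.
- exact: (integrable_indic_itv (- t) t true false).
- apply: measurableT_comp => //; apply: measurableT_comp => //.
  by apply: measurable_funM => //; exact: measurableT_comp.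
- by move=> x; rewrite ger0_norm ?expR_ge0// -expR0 ler_expR oppr_le0 mulr_ge0.
Qed.

Lemma damped_window_ge0 t e x : 0 <= damped_window t e x.
Proof. by rewrite mulr_ge0 ?expR_ge0. Qed.

Lemma damped_window_le t e x : 0 <= e ->
  damped_window t e x <= \1_(`[- t, t]%classic) x.
Proof.
by move=> e0; rewrite ler_piMr// -expR0 ler_expR oppr_le0 mulr_ge0.
Qed.

Lemma Rintegral_window t (h h1 h2 : R -> R) : 0 < t ->
  continuous h1 -> continuous h2 ->
  (forall x, x <= 0 -> h x = h1 x) -> (forall x, 0 <= x -> h x = h2 x) ->
  lambda.-integrable setT (EFin \o (fun x => \1_(`[- t, t]%classic) x * h x)) ->
  \int[lambda]_x (\1_(`[- t, t]%classic) x * h x) =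
  \int[lambda]_(x in `[- t, 0]) h1 x + \int[lambda]_(x in `[0, t]) h2 x.
Proof.
move=> t0 c1 c2 e1 e2 i.
have i1 : lambda.-integrable `[- t, 0]%classic (EFin \o h1).
  apply: continuous_compact_integrable; first exact: segment_compact.
  exact: continuous_subspaceT.
have i2 : lambda.-integrable `[0, t]%classic (EFin \o h2).
  apply: continuous_compact_integrable; first exact: segment_compact.
  exact: continuous_subspaceT.
have i1h : lambda.-integrable `[- t, 0]%classic (EFin \o h).
  apply: eq_integrable i1 => // x; rewrite inE/= in_itv/= => /andP[_ x0].
  by rewrite e1.
have i2h : lambda.-integrable `[0, t]%classic (EFin \o h).
  apply: eq_integrable i2 => // x; rewrite inE/= in_itv/= => /andP[x0 _].
  by rewrite e2.
have i2h' : lambda.-integrable `]0, t]%classic (EFin \o h).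
  by apply: integrableS i2h => //; apply: subset_itvr; rewrite bnd_simp.
have US : `[- t, t]%classic = `[- t, 0]%classic `|` `]0, t]%classic.
  by apply: itv_bndbnd_setU; rewrite bnd_simp ?oppr_le0 ltW.
have disj : `[- t, 0]%classic `&` `]0, t]%classic = set0.
  apply/seteqP; split => // x; rewrite /= !in_itv/= => -[/andP[_ x0] /andP[]].
  by rewrite ltNge x0.
have ih : lambda.-integrable (`[- t, 0]%classic `|` `]0, t]%classic) (EFin \o h).
  rewrite -US integrable_mkcond//; apply: eq_integrable i => // x _ /=.
  by rewrite restrict_EFin/= patch_indic/= mulrC.
transitivity (\int[lambda]_(x in `[- t, t]) h x).
  rewrite [RHS]Rintegral_mkcond; apply: eq_Rintegral => x _.
  by rewrite patch_indic/= mulrC.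
rewrite US Rintegral_setU//; last by apply/disj_setPS; rewrite disj.
rewrite Rintegral_itv_obnd_cbnd//; congr (_ + _).
  by apply: eq_Rintegral => x; rewrite inE/= in_itv/= => /andP[_ x0]; rewrite e1.
by apply: eq_Rintegral => x; rewrite inE/= in_itv/= => /andP[x0 _]; rewrite e2.
Qed.

Lemma Rintegral_damped_window_cos t e b : 0 < t -> 0 < e ->
  \int[lambda]_x (damped_window t e x * cos (x * b)) = abel_kernel e b t.
Proof.
move=> t0 e0.
have neq0 : e ^+ 2 + b ^+ 2 != 0.
  by rewrite gt_eqF// ltr_pwDl ?sqr_ge0// exprn_gt0.
have neq0' : (- e) ^+ 2 + b ^+ 2 != 0 by rewrite sqrrN.
have mcos : measurable_fun [set: measurableTypeR R] (fun x => cos (x * b)).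
  apply: measurableT_comp; first exact: measurable_cos.
  by apply: measurable_funM.
have i := integrable_bounded_mul (integrable_damped_window t (ltW e0)) mcos
  (fun x => normr_cos_le _).
pose h x := expR (- (e * `|x|)) * cos (x * b).
have hE x : damped_window t e x * cos (x * b) = \1_(`[- t, t]%classic) x * h x.
  by rewrite /damped_window -mulrA.
under eq_Rintegral do rewrite hE.
have hneg x : x <= 0 -> h x = expR (x * e) * cos (x * b).
  by move=> x0; rewrite /h ler0_norm// mulrN opprK [e * x]mulrC.
have hpos x : 0 <= x -> h x = expR (x * - e) * cos (x * b).
  by move=> x0; rewrite /h ger0_norm// mulrN [e * x]mulrC.
have ih : lambda.-integrable setT (EFin \o (fun x => \1_(`[- t, t]%classic) x * h x)).
  by apply: eq_integrable i => // x _ /=; rewrite hE.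
have tN : - t < 0 by rewrite oppr_lt0.
rewrite (Rintegral_window t0 (@continuous_exp_cos R e b)
  (@continuous_exp_cos R (- e) b) hneg hpos ih).
rewrite (continuous_FTC2_everywhere tN (@continuous_exp_cos R e b)
  (is_derive_exp_cos_primitive neq0)).
rewrite (continuous_FTC2_everywhere t0 (@continuous_exp_cos R (- e) b)
  (is_derive_exp_cos_primitive neq0')).
rewrite /exp_cos_primitive /abel_kernel !mul0r !mulNr expR0 cos0 sin0 cosN sinN !mulrN sqrrN.
by field.
Qed.

(** The integrand is odd; the contributions of the two half-windows cancel in
    their closed forms. *)
Lemma Rintegral_damped_window_sin t e b : 0 < t -> 0 < e ->
  \int[lambda]_x (damped_window t e x * sin (x * b)) = 0.
Proof.
move=> t0 e0.
have neq0 : e ^+ 2 + b ^+ 2 != 0.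
  by rewrite gt_eqF// ltr_pwDl ?sqr_ge0// exprn_gt0.
have neq0' : (- e) ^+ 2 + b ^+ 2 != 0 by rewrite sqrrN.
have msin : measurable_fun [set: measurableTypeR R] (fun x => sin (x * b)).
  apply: measurableT_comp; first exact: measurable_sin.
  by apply: measurable_funM.
have i := integrable_bounded_mul (integrable_damped_window t (ltW e0)) msin
  (fun x => normr_sin_le _).
pose h x := expR (- (e * `|x|)) * sin (x * b).
have hE x : damped_window t e x * sin (x * b) = \1_(`[- t, t]%classic) x * h x.
  by rewrite /damped_window -mulrA.
under eq_Rintegral do rewrite hE.
have hneg x : x <= 0 -> h x = expR (x * e) * sin (x * b).
  by move=> x0; rewrite /h ler0_norm// mulrN opprK [e * x]mulrC.
have hpos x : 0 <= x -> h x = expR (x * - e) * sin (x * b).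
  by move=> x0; rewrite /h ger0_norm// mulrN [e * x]mulrC.
have ih : lambda.-integrable setT (EFin \o (fun x => \1_(`[- t, t]%classic) x * h x)).
  by apply: eq_integrable i => // x _ /=; rewrite hE.
have tN : - t < 0 by rewrite oppr_lt0.
rewrite (Rintegral_window t0 (@continuous_exp_sin R e b)
  (@continuous_exp_sin R (- e) b) hneg hpos ih).
rewrite (continuous_FTC2_everywhere tN (@continuous_exp_sin R e b)
  (is_derive_exp_sin_primitive neq0)).
rewrite (continuous_FTC2_everywhere t0 (@continuous_exp_sin R (- e) b)
  (is_derive_exp_sin_primitive neq0')).
rewrite /exp_sin_primitive !mul0r !mulNr expR0 cos0 sin0 cosN sinN !mulrN sqrrN.
by field.
Qed.

(** The integrand has absolute value at most [1] on a window of length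
    [2 t]. *)
Lemma normr_abel_kernel_le_width t e b : 0 < t -> 0 < e ->
  `|abel_kernel e b t| <= 2 * t.
Proof.
move=> t0 e0; rewrite -Rintegral_damped_window_cos//.
have iw := integrable_damped_window t (ltW e0).
have mcos : measurable_fun [set: measurableTypeR R] (fun x => cos (x * b)).
  apply: measurableT_comp; first exact: measurable_cos.
  by apply: measurable_funM.
have i := integrable_bounded_mul iw mcos (fun x => normr_cos_le _).
apply: le_trans (le_normr_Rintegral measurableT i) _.
have i1 := integrable_indic_itv (- t) t true false.
have -> : 2 * t = \int[lambda]_x (\1_(`[- t, t]%classic) x).
  transitivity (fine (lambda `[- t, t]%classic)).
    rewrite lebesgue_measure_itv/= lte_fin gtrN//= opprK.
    by rewrite mulr2n mulrDl mul1r.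
  by rewrite /Rintegral integral_indic// setIT.
apply: le_Rintegral => //; first exact: integrable_norm.
move=> x _; rewrite normrM ger0_norm ?damped_window_ge0//.
apply: le_trans (damped_window_le t x (ltW e0)).
by rewrite ler_piMr ?damped_window_ge0// normr_cos_le.
Qed.

(** The closed form is at most [2 (2 e + |b|) / (e ^ 2 + b ^ 2)], and
    [2 e |b| <= e ^ 2 + b ^ 2]: the bound does not depend on the damping. *)
Lemma normr_abel_kernel_le_freq t e b : 0 < t -> 0 < e -> b != 0 ->
  `|abel_kernel e b t| <= 4 * `|b|^-1.
Proof.
move=> t0 e0 b0; have b0' : 0 < `|b| by rewrite normr_gt0.
have u1 : expR (- (t * e)) <= 1.
  by rewrite -expR0 ler_expR oppr_le0 mulr_ge0// ltW.
have num : `|e + expR (- (t * e)) * (b * sin (t * b) - e * cos (t * b))| <=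
    2 * e + `|b|.
  apply: le_trans (ler_normD _ _) _; rewrite gtr0_norm// normrM ger0_norm ?expR_ge0//.
  have h : `|b * sin (t * b) - e * cos (t * b)| <= `|b| + e.
    apply: le_trans (ler_normB _ _) _; rewrite !normrM (gtr0_norm e0).
    apply: lerD; first by rewrite ler_piMr// normr_sin_le.
    by rewrite ler_piMr ?normr_cos_le// ltW.
  have := ler_pM (expR_ge0 _) (normr_ge0 _) u1 h; lra.
rewrite /abel_kernel normrM normrM normfV (gtr0_norm (_ : 0 < 2))//.
have d0 : 0 < e ^+ 2 + b ^+ 2 by rewrite ltr_pwDl ?sqr_ge0// exprn_gt0.
rewrite (gtr0_norm d0) ler_pdivrMr// mulrAC ler_pdivlMr//.
rewrite -(real_normK (num_real b)).
have : 0 <= (e - `|b|) ^+ 2 by exact: sqr_ge0.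
have : 0 <= e ^+ 2 by exact: sqr_ge0.
move: num; set X := `|e + _|; set B := `|b| in b0' *; nra.
Qed.

(** The kernel at frequency [0] is the mass of the window; it is what bounds the
    absolute integrals in Fubini's theorem. *)
Lemma normr_abel_kernel0_le t e : 0 < t -> 0 < e ->
  `|abel_kernel e 0 t| <= 4 * e^-1.
Proof.
move=> t0 e0; rewrite /abel_kernel mulr0 sin0 cos0 mul0r expr0n/= addr0.
have u1 : expR (- (t * e)) <= 1.
  by rewrite -expR0 ler_expR oppr_le0 mulr_ge0// ltW.
have u0 := expR_ge0 (- (t * e)).
have -> : 2 * (e + expR (- (t * e)) * (0 - e * 1)) / e ^+ 2 =
    2 * (1 - expR (- (t * e))) * e^-1.
  by field; rewrite gt_eqF.
rewrite normrM (gtr0_norm (_ : 0 < e^-1)) ?invr_gt0//.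
rewrite ler_pM2r ?invr_gt0// ger0_norm; lra.
Qed.

Lemma cvg_abel_kernel t b (T : Type) (F : set_system T) (FF : Filter F)
    (u : T -> R) : b != 0 -> u x @[x --> F] --> 0 ->
  abel_kernel (u x) b t @[x --> F] --> 2 * (sin (t * b) / b).
Proof.
move=> b0 u0.
have -> : 2 * (sin (t * b) / b) = abel_kernel 0 b t.
  by rewrite /abel_kernel mulr0 oppr0 expR0 expr0n/=; field.
apply: cvgM; last first.
  apply: cvgV; first by rewrite expr0n/= add0r expf_neq0.
  by apply: cvgD; [rewrite expr2; apply: cvgM|exact: cvg_cst].
apply: cvgM; first exact: cvg_cst.
apply: cvgD => //; apply: cvgM.
  apply: (continuous_cvg _ (@continuous_expR R (- (t * 0)))).
  by apply: cvgN; apply: cvgM => //; exact: cvg_cst.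
apply: cvgB; first exact: cvg_cst.
by apply: cvgM => //; exact: cvg_cst.
Qed.

End abel_kernel.

(** * Products of windows and moments of the tail *)

Lemma measurable_fun_leR d (T : measurableType d) (R : realType) (f g : T -> R) :
  measurable_fun setT f -> measurable_fun setT g ->
  measurable_fun setT (fun z => (f z <= g z)%R%:R : R).
Proof.
move=> mf mg.
have mS : measurable [set z | f z <= g z].
  by have := measurable_fun_ler mf mg measurableT (Y := [set true]) I; rewrite setTI.
rewrite (_ : (fun z => _) = \1_[set z | f z <= g z]); first exact: measurable_indic.
by apply/funext => z; rewrite indicE mem_setE.
Qed.

Section tail_fubini.
Context (R : realType) (n : nat).
Implicit Types (x t xi eps r : 'rV[R]_n).
Local Notation lambda := (@lebesgue_rV R n).

Definition min_prod r t : R := \prod_k Num.min (r ord0 k) (t ord0 k).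

Definition damping eps x : R := expR (- \sum_k eps ord0 k * `|x ord0 k|).

Definition abel_kernel_prod eps xi t : R :=
  \prod_k abel_kernel (eps ord0 k) (xi ord0 k) (t ord0 k).

(** As a function of [x] and [t], the damped indicator of [|x_k| <= t_k] for all
    [k]: a window in [x] and, by [windowE], the indicator of an upper box in
    [t]. *)
Definition window eps t : 'rV[R]_n -> R :=
  tensor (fun k => damped_window (t ord0 k) (eps ord0 k)).

Lemma damped_windowE (s e y : R) :
  damped_window s e y = (`|y| <= s)%R%:R * expR (- (e * `|y|)).
Proof. by rewrite /damped_window indicE mem_setE in_itv/= ler_norml. Qed.

Lemma windowE eps t x :
  window eps t x = \1_(upper_box (abs_coord x)) t * damping eps x.
Proof.
rewrite /window /tensor; under eq_bigr do rewrite damped_windowE.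
rewrite big_split/= /damping -sumrN expR_sum; congr (_ * _).
rewrite indicE; have [tx|tx] := boolP (t \in _).
  rewrite big1// => k _; move: tx; rewrite inE => /(_ k).
  by rewrite mxE => ->.
move: tx; rewrite notin_setE => /existsNP[k]; rewrite mxE => /negP kt.
by rewrite (bigD1 k)//= (negbTE kt) mul0r.
Qed.

Lemma window_ge0 eps t x : 0 <= window eps t x.
Proof. by apply: prodr_ge0 => k _; exact: damped_window_ge0. Qed.

Lemma measurable_window eps :
  measurable_fun [set: 'rV[R]_n * 'rV[R]_n] (fun z => window eps z.2 z.1).
Proof.
apply: measurable_prod => k _.
have m1 : measurable_fun [set: 'rV[R]_n * 'rV[R]_n] (fun z => z.1 ord0 k).
  exact: measurableT_comp (measurable_rV_coord k) measurable_fst.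
have m2 : measurable_fun [set: 'rV[R]_n * 'rV[R]_n] (fun z => z.2 ord0 k).
  exact: measurableT_comp (measurable_rV_coord k) measurable_snd.
have mabs : measurable_fun [set: 'rV[R]_n * 'rV[R]_n] (fun z => `|z.1 ord0 k|).
  exact: measurableT_comp m1.
rewrite (_ : (fun z => _) = (fun z : 'rV[R]_n * 'rV[R]_n =>
    (`|z.1 ord0 k| <= z.2 ord0 k)%R%:R * expR (- (eps ord0 k * `|z.1 ord0 k|)))).
  apply: measurable_funM; first exact: measurable_fun_leR.
  apply: measurableT_comp; first exact: measurable_expR.
  by apply: measurableT_comp => //; exact: measurable_funM.
by apply/funext => z; rewrite damped_windowE.
Qed.

Lemma measurable_damping eps : measurable_fun setT (damping eps).
Proof.
apply: measurableT_comp; first exact: measurable_expR.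
apply: measurableT_comp => //; apply: measurable_sum => k.
apply: measurable_funM => //; apply: measurableT_comp => //.
exact: measurable_rV_coord.
Qed.

Lemma damping_ge0 eps x : 0 <= damping eps x.
Proof. exact: expR_ge0. Qed.

Lemma measurable_min_prod r : measurable_fun setT (min_prod r).
Proof.
apply: measurable_prod => k _; apply: measurable_minr => //.
exact: measurable_rV_coord.
Qed.

Lemma min_prod_ge0 r t : orthant r -> orthant t -> 0 <= min_prod r t.
Proof.
by move=> r0 t0; apply: prodr_ge0 => k _; rewrite le_min !ltW.
Qed.

Lemma measurable_upper_box x : measurable (upper_box x).
Proof.
rewrite (_ : upper_box x =
    [set t : 'rV[R]_n | forall k, `[x ord0 k, +oo[%classic (t ord0 k)]).
  exact: (@measurable_coordwise _ _ (fun k => `[x ord0 k, +oo[%classic)).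
by apply/seteqP; split => t /= tx k; have := tx k; rewrite /= in_itv/= andbT.
Qed.

(** Chebyshev's inequality in disguise: it gives [upper_box x] finite mass. *)
Lemma indic_upper_box_le x t : orthant x -> orthant t ->
  \1_(upper_box x) t * \prod_k x ord0 k <= min_prod x t.
Proof.
move=> x0 t0; rewrite indicE; have [|_] := boolP (t \in _).
  rewrite inE => tx; rewrite mul1r; apply: ler_prod => k _.
  by rewrite ltW//= le_min lexx; exact: tx.
by rewrite mul0r min_prod_ge0.
Qed.

(** Each one-dimensional kernel is bounded both by the width of the window and
    by the inverse of the frequency. *)
Lemma normr_abel_kernel_prod_le eps xi t : orthant eps -> no_zero_coord xi ->
  orthant t ->
  `|abel_kernel_prod eps xi t| <= 4 ^+ n * min_prod (inv_abs_coord xi) t.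
Proof.
move=> e0 xi0 t0; rewrite normr_prod -[n in _ ^+ n]card_ord -prodr_const -big_split/=.
apply: ler_prod => k _; rewrite normr_ge0/= minr_pMr// le_min mxE.
rewrite (normr_abel_kernel_le_freq (t0 k) (e0 k) (xi0 k))/=.
apply: le_trans (normr_abel_kernel_le_width _ (t0 k) (e0 k)) _.
by rewrite ler_pM2r ?ler_nat//; exact: t0.
Qed.

Lemma normr_abel_kernel_prod0_le eps t : orthant eps -> orthant t ->
  `|abel_kernel_prod eps 0 t| <= 4 ^+ n * min_prod (inv_abs_coord eps) t.
Proof.
move=> e0 t0; rewrite normr_prod -[n in _ ^+ n]card_ord -prodr_const -big_split/=.
apply: ler_prod => k _; rewrite normr_ge0/= minr_pMr// le_min !mxE.
rewrite (gtr0_norm (e0 k)) (normr_abel_kernel0_le (t0 k) (e0 k))/=.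
apply: le_trans (normr_abel_kernel_le_width _ (t0 k) (e0 k)) _.
by rewrite ler_pM2r ?ler_nat//; exact: t0.
Qed.

Lemma orthant_inv_abs_coord xi : no_zero_coord xi -> orthant (inv_abs_coord xi).
Proof. by move=> xi0 k; rewrite mxE invr_gt0 normr_gt0; exact: xi0. Qed.

Lemma orthant_no_zero_coord eps : orthant eps -> no_zero_coord eps.
Proof. by move=> e0 k; rewrite gt_eqF. Qed.

Lemma window_trig eps xi t : orthant eps -> orthant t ->
  [/\ lambda.-integrable setT (EFin \o window eps t),
      \int[lambda]_x (window eps t x * cos (dot x xi)) = abel_kernel_prod eps xi t &
      \int[lambda]_x (window eps t x * sin (dot x xi)) = 0].
Proof.
move=> e0 t0.
have [k|k|i c s] := @Rintegral_tensor_trig R n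
  (fun k => damped_window (t ord0 k) (eps ord0 k)) xi.
- by apply: integrable_damped_window; exact: ltW.
- exact: Rintegral_damped_window_sin.
split => //; rewrite c; apply: eq_bigr => k _.
exact: Rintegral_damped_window_cos.
Qed.

Lemma Rintegral_window_eq eps t : orthant eps -> orthant t ->
  \int[lambda]_x window eps t x = abel_kernel_prod eps 0 t.
Proof.
move=> e0 t0; have [_ <- _] := window_trig 0 e0 t0.
apply: eq_Rintegral => x _; rewrite /dot big1 ?cos0 ?mulr1// => k _.
by rewrite mxE mulr0.
Qed.

End tail_fubini.

(** * Fubini's theorem for the damped tails *)

Section abel_fubini.
Context (R : realType) (n : nat).
Implicit Types (x t xi eps r : 'rV[R]_n).
Local Notation lambda := (@lebesgue_rV R n).
Variable P : {sigma_finite_measure set 'rV[R]_n -> \bar R}.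
Hypothesis Pmin : forall r, orthant r -> P.-integrable orthant (EFin \o min_prod r).

Let mO := @measurable_orthant R n.

Lemma orthant_restrict (g : 'rV[R]_n -> R) :
  (fun t => (\1_orthant t * g t)%:E) = (EFin \o g) \_ orthant.
Proof.
by apply/funext => t; rewrite restrict_EFin/= patch_indic/= mulrC.
Qed.

(** The tail of [P] at [|x|], that is, the contribution of a Jordan part to
    [f x]. *)
Definition tail_mass x : R :=
  \int[P]_(t in orthant) \1_(upper_box (abs_coord x)) t.

Definition damped_tail eps (c : 'rV[R]_n -> R) (z : 'rV[R]_n * 'rV[R]_n) : \bar R :=
  (\1_orthant z.2 * (window eps z.2 z.1 * c z.1))%:E.

(** Off the coordinate hyperplanes this is [tail_mass x * damping eps x * c x]
    ([damped_tail_intE]).  The extended-real form is kept because the tail may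
    be infinite on the hyperplanes. *)
Definition damped_tail_int eps (c : 'rV[R]_n -> R) x : \bar R :=
  (\int[P]_t damped_tail eps c (x, t))%E.

(** Integrating first in [x], the mass of the window is at most
    [4 ^ n prod_k min (1 / eps_k, t_k)], which has a finite integral. *)
Lemma integrable_damped_tail eps (c : 'rV[R]_n -> R) : orthant eps ->
  measurable_fun setT c -> (forall x, `|c x| <= 1) ->
  (lambda \x P)%E.-integrable setT (damped_tail eps c).
Proof.
move=> e0 mc c1.
have mF : measurable_fun setT (damped_tail eps c).
  apply/measurable_EFinP; apply: measurable_funM.
    have mI : measurable_fun setT (\1_orthant : 'rV[R]_n -> R).
      exact: measurable_indic.
    exact: (measurableT_comp mI measurable_snd).
  apply: measurable_funM; first exact: measurable_window.
  exact: measurableT_comp mc measurable_fst.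
apply/(integrable21ltyP _ _ mF).
have mG : measurable_fun setT (fun t => \int[lambda]_x `|damped_tail eps c (x, t)|)%E.
  apply: (@measurable_fun_fubini_tonelli_G _ _ _ _ _ lambda (abse \o damped_tail eps c)) => [|z].
    exact: measurableT_comp.
  exact: abse_ge0.
pose bnd t := (\1_orthant t * (4 ^+ n * min_prod (inv_abs_coord eps) t))%:E.
have ibnd : P.-integrable setT bnd.
  rewrite /bnd orthant_restrict -integrable_mkcond//.
  apply: eq_integrable (integrableZl mO (4 ^+ n)
    (Pmin (orthant_inv_abs_coord (orthant_no_zero_coord e0)))) => // t _ /=.
have bnd0 t : (0 <= bnd t)%E.
  rewrite lee_fin indicE; have [|_] := boolP (t \in _); last by rewrite mul0r.
  rewrite inE mul1r => t0; rewrite mulr_ge0 ?exprn_ge0//.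
  by apply: min_prod_ge0 => //; apply/orthant_inv_abs_coord/orthant_no_zero_coord.
have /integrableP[_ bndoo] := ibnd.
apply: le_lt_trans bndoo; apply: ge0_le_integral => //.
- by move=> t _; exact: integral_ge0.
- by apply: measurableT_comp => //; exact: measurable_int ibnd.
- move=> t _; rewrite gee0_abs//.
  have [tO|tO] := pselect (orthant t); last first.
    rewrite (_ : (fun x => _) = cst 0%E) ?integral0 ?bnd0//.
    by apply/funext => x; rewrite /damped_tail/= indicE memNset// mul0r normr0.
  have [iw _ _] := window_trig 0 e0 tO.
  apply: (@le_trans _ _ (\int[lambda]_x (window eps t x)%:E)%E).
    apply: ge0_le_integral => //.
    + apply: measurableT_comp => //.
      exact: (measurableT_comp mF (pair2_measurable t)).
    + exact: measurable_int iw.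
    + move=> x _; rewrite lee_fin/= indicE mem_set// mul1r normrM.
      by rewrite ger0_norm ?window_ge0// ler_piMr// window_ge0.
  rewrite /bnd -(fineK (integrable_fin_num _ iw))// lee_fin.
  rewrite -/(Rintegral lambda setT (window eps t)) Rintegral_window_eq//.
  rewrite indicE mem_set// mul1r.
  exact: le_trans (ler_norm _) (normr_abel_kernel_prod0_le e0 tO).
Qed.

Lemma integral_damped_tail_int eps (c : 'rV[R]_n -> R) : orthant eps ->
  measurable_fun setT c -> (forall x, `|c x| <= 1) ->
  lambda.-integrable setT (damped_tail_int eps c) /\
  (\int[lambda]_x damped_tail_int eps c x =
   \int[P]_(t in orthant) (\int[lambda]_x (window eps t x * c x))%R%:E)%E.
Proof.
move=> e0 mc c1; have iF := integrable_damped_tail e0 mc c1.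
split; first exact: (integrable_fubini_F iF).
rewrite /damped_tail_int (Fubini iF) [RHS]integral_mkcond.
apply: eq_integral => t _.
rewrite -(orthant_restrict (fun t => \int[lambda]_x (window eps t x * c x))).
have [tO|tO] := pselect (orthant t); last first.
  rewrite indicE memNset// mul0r (_ : (fun x => _) = cst 0%E) ?integral0//.
  by apply/funext => x; rewrite /damped_tail/= indicE memNset// mul0r.
have [iw _ _] := window_trig 0 e0 tO.
rewrite indicE mem_set// mul1r /Rintegral fineK; last first.
  by apply: integrable_fin_num => //; exact: integrable_bounded_mul.
by apply: eq_integral => x _; rewrite /damped_tail/= indicE mem_set// mul1r.
Qed.

Lemma damped_tail_intE eps (c : 'rV[R]_n -> R) x : no_zero_coord x ->
  damped_tail_int eps c x = (tail_mass x * (damping eps x * c x))%:E.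
Proof.
move=> x0.
have a0 : orthant (abs_coord x).
  by move=> k; rewrite mxE normr_gt0; exact: x0.
have p0 : 0 < \prod_k (abs_coord x) ord0 k by apply: prodr_gt0 => k _; exact: a0.
have mbox : measurable_fun orthant (\1_(upper_box (abs_coord x)) : 'rV[R]_n -> R).
  by apply: measurable_indic; exact: measurable_upper_box.
have ibox : P.-integrable orthant (EFin \o \1_(upper_box (abs_coord x))).
  apply: (le_integrable mO _ _ (integrableZl mO
    (\prod_k (abs_coord x) ord0 k)^-1 (Pmin a0))); first exact/measurable_EFinP.
  move=> t tO /=; rewrite lee_fin ger0_norm// ger0_norm; last first.
    by apply: mulr_ge0; [rewrite invr_ge0 ltW|exact: min_prod_ge0].
  by rewrite mulrC ler_pdivlMr//; exact: indic_upper_box_le.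
rewrite /tail_mass -RintegralZr//= /Rintegral fineK; last first.
  apply: integrable_fin_num => //=.
  by under eq_fun do rewrite EFinM; exact: integrableZr.
rewrite /damped_tail_int [RHS]integral_mkcond; apply: eq_integral => t _.
rewrite -(orthant_restrict (fun t => \1_(upper_box (abs_coord x)) t * _)).
by rewrite /damped_tail/= windowE -mulrA.
Qed.

End abel_fubini.

(** * Dominated convergence and measurability of the kernels *)

(** Dominated convergence along a filter that is not a sequence; the bound is
    only required on the trace [A]. *)
Lemma cvg_Rintegral_within (R : realType) (U : pseudoMetricType R) (a : U)
    (A : set U) d (T : measurableType d) (m : {measure set T -> \bar R})
    (D : set T) (F : U -> T -> R) (F0 G : T -> R) :
  measurable D -> (forall u, A u -> measurable_fun D (F u)) ->
  measurable_fun D F0 -> m.-integrable D (EFin \o G) ->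
  (forall u t, A u -> D t -> `|F u t| <= G t) ->
  (forall t, D t -> F u t @[u --> within A (nbhs a)] --> F0 t) ->
  \int[m]_(t in D) F u t @[u --> within A (nbhs a)] --> \int[m]_(t in D) F0 t.
Proof.
move=> mD mF mF0 iG FG FF0; apply: cvg_within_seq => u uA ua.
have uw : u @ \oo --> within A (nbhs a).
  move=> B aB.
  have : \forall k \near \oo, A (u k) -> B (u k) by exact: (ua _ aB).
  by apply: filterS => k h; exact: h (uA k).
have [] := @dominated_convergence _ _ _ m D mD
  (fun k t => (F (u k) t)%:E) (fun t => (F0 t)%:E) (fun t => (G t)%:E).
- by move=> k; apply/measurable_EFinP; exact: mF.
- exact/measurable_EFinP.
- apply: aeW => t Dt; apply: cvg_EFin; first exact: nearW.
  exact: cvg_comp uw (FF0 t Dt).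
- exact: iG.
- by apply: aeW => t k Dt; rewrite lee_fin FG.
move=> iF0 _ cv; rewrite /Rintegral; apply: fine_cvg.
by rewrite fineK //; exact: integrable_fin_num.
Qed.

Lemma cvg_coord (R : realType) n (a : 'rV[R]_n) (A : set 'rV[R]_n) k :
  (fun u : 'rV[R]_n => u ord0 k) u @[u --> within A (nbhs a)] --> a ord0 k.
Proof. by apply: cvg_within_filter; exact: coord_continuous. Qed.

Lemma abel_filter_proper (R : realType) n : ProperFilter (@abel_filter R n).
Proof.
apply: Build_ProperFilter_ex => B; rewrite /abel_filter /within/=.
move=> /nbhs_ballP[e /= e0 eB]; exists (const_mx (e / 2)); apply: eB.
  split => // i j; rewrite !mxE /ball/= sub0r normrN gtr0_norm ?divr_gt0//.
  by rewrite ltr_pdivrMr// ltr_pMr// ltr1n.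
by move=> k; rewrite mxE divr_gt0.
Qed.

Section measurable_kernels.
Context (R : realType).

Lemma measurable_inv : measurable_fun setT (@GRing.inv R).
Proof.
(* A continuous approximation that is correct at 0 too, where 0^-1 = 0. *)
pose h k (x : R) := x * (x ^+ 2 + k.+1%:R^-1)^-1.
apply: (@measurable_fun_cvg _ _ _ _ h) => [k|x _].
  apply: continuous_measurable_fun => x; rewrite /h.
  apply: cvgM => //; apply: cvgV.
    by rewrite gt_eqF// ltr_wpDl ?sqr_ge0// invr_gt0.
  by apply: cvgD; [rewrite expr2; apply: cvgM|exact: cvg_cst].
have [->|x0] := eqVneq x 0.
  by rewrite invr0 /h; under eq_fun do rewrite mul0r; exact: cvg_cst.
have -> : x^-1 = x * (x ^+ 2 + 0)^-1.
  by rewrite addr0 expr2 invfM mulrA mulfV// mul1r.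
apply: cvgM; first exact: cvg_cst.
apply: cvgV; first by rewrite addr0 sqrf_eq0.
apply: cvgD; first exact: cvg_cst.
exact: cvg_harmonic.
Qed.

Lemma measurable_abel_kernel (e b : R) : measurable_fun setT (abel_kernel e b).
Proof.
have mte (c : R) : measurable_fun setT (fun t : R => t * c).
  by apply: measurable_funM.
apply: measurable_funM => //; apply: measurable_funM => //.
apply: measurable_funD => //; apply: measurable_funM.
  apply: measurableT_comp; first exact: measurable_expR.
  exact: measurableT_comp (mte e).
apply: measurable_funB; apply: measurable_funM => //.
  exact: measurableT_comp (@measurable_sin R) (mte b).
exact: measurableT_comp (@measurable_cos R) (mte b).
Qed.

Lemma measurable_abel_kernel_prod n (eps xi : 'rV[R]_n) :
  measurable_fun setT (abel_kernel_prod eps xi).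
Proof.
apply: measurable_prod => k _.
by apply: (measurableT_comp (measurable_abel_kernel _ _)); exact: measurable_rV_coord.
Qed.

Lemma measurable_sin_kernel2 n :
  measurable_fun [set: 'rV[R]_n * 'rV[R]_n] (fun z => sin_kernel z.1 z.2).
Proof.
apply: measurable_prod => k _.
have m1 : measurable_fun [set: 'rV[R]_n * 'rV[R]_n] (fun z => z.1 ord0 k).
  exact: measurableT_comp (measurable_rV_coord k) measurable_fst.
have m2 : measurable_fun [set: 'rV[R]_n * 'rV[R]_n] (fun z => z.2 ord0 k).
  exact: measurableT_comp (measurable_rV_coord k) measurable_snd.
apply: measurable_funM; last exact: (measurableT_comp measurable_inv m1).
apply: (measurableT_comp (@measurable_sin R)).
exact: measurable_funM.
Qed.

Lemma measurable_sin_kernel n (xi : 'rV[R]_n) : measurable_fun setT (sin_kernel xi).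
Proof.
exact: (measurableT_comp (@measurable_sin_kernel2 n) (pair1_measurable xi)).
Qed.

(** The sine kernel inherits the bound by the width as the undamped limit of
    the damped kernels. *)
Lemma normr_sin_div_le (t b : R) : 0 < t -> b != 0 ->
  `|sin (t * b) / b| <= Num.min `|b|^-1 t.
Proof.
move=> t0 b0; rewrite le_min; apply/andP; split.
  by rewrite normrM normfV ler_piMl ?invr_ge0// normr_sin_le.
have cvh : harmonic @ \oo --> (0 : R) by exact: cvg_harmonic.
have cv : `|abel_kernel k.+1%:R^-1 b t| @[k --> \oo] --> `|2 * (sin (t * b) / b)|.
  by apply: cvg_norm; exact: cvg_abel_kernel.
have h : `|2 * (sin (t * b) / b)| <= 2 * t.
  rewrite -(cvg_lim (@Rhausdorff R) cv); apply: limr_le.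
    by apply/cvg_ex; eexists; exact: cv.
  by apply: nearW => k; apply: normr_abel_kernel_le_width; rewrite // invr_gt0.
by move: h; rewrite normrM gtr0_norm// ler_pM2l.
Qed.

Lemma normr_sin_kernel_le n (xi t : 'rV[R]_n) : no_zero_coord xi -> orthant t ->
  `|sin_kernel xi t| <= min_prod (inv_abs_coord xi) t.
Proof.
move=> xi0 t0; rewrite normr_prod; apply: ler_prod => k _.
by rewrite normr_ge0/= mxE; apply: normr_sin_div_le; [exact: t0|exact: xi0].
Qed.

(** Splitting into positive and negative parts, Tonelli's theorem gives
    measurability without any integrability. *)
Lemma measurable_integral_param d1 d2 (T1 : measurableType d1)
    (T2 : measurableType d2) (m : {sigma_finite_measure set T2 -> \bar R})
    (h : T1 * T2 -> \bar R) : measurable_fun setT h ->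
  measurable_fun setT (fun x => \int[m]_y h (x, y))%E.
Proof.
move=> mh.
rewrite (_ : (fun x => _) = (fun x => fubini_F m h^\+ x - fubini_F m h^\- x)%E).
  by apply: emeasurable_funB; apply: measurable_fun_fubini_tonelli_F => //;
    [exact: measurable_funepos|exact: measurable_funeneg].
apply/funext => x; rewrite [LHS]integralE /fubini_F.
by congr (_ - _)%E; apply: eq_integral => y _; rewrite ?funeposE ?funenegE.
Qed.

Lemma eq_ae_Rintegral d (T : measurableType d) (m : {measure set T -> \bar R})
    (f : T -> R) (h : T -> \bar R) : measurable_fun setT f ->
  m.-integrable setT h -> {ae m, forall x, (f x)%:E = h x} ->
  m.-integrable setT (EFin \o f) /\ \int[m]_x f x = fine (\int[m]_x h x)%E.
Proof.
move=> mf ih fh; have mEf : measurable_fun setT (EFin \o f) by exact/measurable_EFinP.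
have mh := measurable_int _ ih.
split; last first.
  rewrite /Rintegral; congr fine; apply: ae_eq_integral => //.
  by apply: filterS fh => x + _.
apply/integrableP; split => //; have /integrableP[_] := ih.
apply: le_lt_trans; rewrite le_eqVlt; apply/orP; left; apply/eqP.
apply: ae_eq_integral => //.
- exact: measurableT_comp.
- exact: measurableT_comp.
- by apply: filterS fh => x fx _; rewrite -fx.
Qed.

End measurable_kernels.

(** * Integrals of the kernels against a positive measure *)

Lemma cvg_prodr (R : realType) (T : Type) (F : set_system T) (FF : Filter F)
    n (f : 'I_n -> T -> R) (l : 'I_n -> R) :
  (forall k, f k x @[x --> F] --> l k) ->
  \prod_k f k x @[x --> F] --> \prod_k l k.
Proof.
move=> fl; apply: cvg_big => // z.
by apply: cvgM; [exact: cvg_fst|exact: cvg_snd].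
Qed.

Section kernel_integrals.
Context (R : realType) (n : nat).
Implicit Types (x t xi eps r : 'rV[R]_n).
Local Notation lambda := (@lebesgue_rV R n).
Variable Q : {sigma_finite_measure set 'rV[R]_n -> \bar R}.
Hypothesis Qmin : forall r, orthant r -> Q.-integrable orthant (EFin \o min_prod r).

Let mO := @measurable_orthant R n.

Lemma integrable_sin_kernel xi : no_zero_coord xi ->
  Q.-integrable orthant (EFin \o sin_kernel xi).
Proof.
move=> xi0; apply: (le_integrable mO _ _ (Qmin (orthant_inv_abs_coord xi0))).
  by apply/measurable_EFinP; apply: measurable_funS (measurable_sin_kernel xi).
move=> t tO /=; rewrite lee_fin; apply: le_trans (normr_sin_kernel_le xi0 tO) _.
exact: ler_norm.
Qed.

Lemma cvg_abel_kernel_integral xi : no_zero_coord xi ->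
  \int[Q]_(t in orthant) abel_kernel_prod eps xi t
    @[eps --> @abel_filter R n] -->
  2 ^+ n * \int[Q]_(t in orthant) sin_kernel xi t.
Proof.
move=> xi0; rewrite -RintegralZl//; last exact: integrable_sin_kernel.
apply: (@cvg_Rintegral_within _ _ _ _ _ _ _ _ _ _
  (fun t => 4 ^+ n * min_prod (inv_abs_coord xi) t)) => //.
- by move=> eps _; apply: measurable_funS (measurable_abel_kernel_prod eps xi).
- apply: measurable_funM => //; apply: measurable_funS (measurable_sin_kernel xi) => //.
- exact: (integrableZl mO _ (Qmin (orthant_inv_abs_coord xi0))).
- by move=> eps t e0 t0; exact: normr_abel_kernel_prod_le.
- move=> t t0; rewrite /sin_kernel -[n in 2 ^+ n]card_ord -prodr_const -big_split/=.
  rewrite /abel_kernel_prod.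
  apply: cvg_prodr => k; apply: cvg_abel_kernel; first exact: xi0.
  have := @cvg_coord R n 0 orthant k; by rewrite mxE.
Qed.

(** Near [xi0] the coordinates stay larger than half of their values at [xi0],
    whence a single dominating function. *)
Lemma continuous_sin_kernel_integral xi0 : no_zero_coord xi0 ->
  \int[Q]_(t in orthant) sin_kernel xi t @[xi --> xi0] -->
  \int[Q]_(t in orthant) sin_kernel xi0 t.
Proof.
move=> nz0.
pose A : set 'rV[R]_n := [set xi | forall k, `|xi0 ord0 k| / 2 < `|xi ord0 k|].
have nA : \forall xi \near xi0, A xi.
  have h k : nbhs xi0 [set xi : 'rV[R]_n | `|xi0 ord0 k| / 2 < `|xi ord0 k|].
    have cv : (fun xi : 'rV[R]_n => `|xi ord0 k|) xi @[xi --> xi0] --> `|xi0 ord0 k|.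
      apply: cvg_norm; first exact: nbhs_filter.
      exact: coord_continuous.
    apply: (cvgr_gt _ cv); rewrite ltr_pdivrMr// ltr_pMr ?ltr1n// normr_gt0.
    exact: nz0.
  exact: filter_forall h.
have A0 xi : A xi -> no_zero_coord xi.
  by move=> Axi k; rewrite -normr_gt0 (le_lt_trans _ (Axi k))// divr_ge0.
suff : \int[Q]_(t in orthant) sin_kernel xi t @[xi --> within A (nbhs xi0)] -->
  \int[Q]_(t in orthant) sin_kernel xi0 t.
  by move=> h B /h; rewrite /within/= => nB; apply: filterS2 nA nB => xi Axi; apply.
pose r : 'rV[R]_n := \row_k (`|xi0 ord0 k| / 2)^-1.
have r0 : orthant r.
  by move=> k; rewrite mxE invr_gt0 divr_gt0// normr_gt0; exact: nz0.
apply: (@cvg_Rintegral_within _ _ _ _ _ _ _ _ _ _ (min_prod r)) => //.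
- by move=> xi _; apply: measurable_funS (measurable_sin_kernel xi).
- by apply: measurable_funS (measurable_sin_kernel xi0).
- exact: Qmin.
- move=> xi t Axi t0; apply: le_trans (normr_sin_kernel_le (A0 _ Axi) t0) _.
  apply: ler_prod => k _; rewrite !mxE le_min invr_ge0 normr_ge0 (ltW (t0 k))/=.
  rewrite le_min !ge_min lexx !orbT andbT; apply/orP; left.
  have p0 : 0 < `|xi0 ord0 k| / 2 by rewrite divr_gt0// normr_gt0; exact: nz0.
  have p1 : 0 < `|xi ord0 k| by exact: lt_trans p0 (Axi k).
  by rewrite lef_pV2 ?posrE// ltW//; exact: Axi.
- move=> t t0; rewrite /sin_kernel; apply: cvg_prodr => k; have ck := @cvg_coord R n xi0 A k.
  apply: cvgM; last by apply: cvgV => //; exact: nz0.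
  apply: (continuous_cvg _ (@continuous_sin R _)).
  by apply: cvgM => //; exact: cvg_cst.
Qed.

Lemma measurable_sin_kernel_integral : measurable_fun setT
  (fun xi => if `[< no_zero_coord xi >] then \int[Q]_(t in orthant) sin_kernel xi t else 0).
Proof.
(* Masking with indicators turns the case distinction and the domain of
   integration into one jointly measurable function. *)
pose h (z : 'rV[R]_n * 'rV[R]_n) : \bar R :=
  (\1_no_zero_coord z.1 * (\1_orthant z.2 * sin_kernel z.1 z.2))%:E.
have mI (S : set 'rV[R]_n) : measurable S -> measurable_fun setT (\1_S : 'rV[R]_n -> R).
  by move=> mS; exact: measurable_indic.
have mh : measurable_fun setT h.
  apply/measurable_EFinP; apply: measurable_funM.
    exact: (measurableT_comp (mI _ measurable_no_zero_coord) measurable_fst).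
  apply: measurable_funM; last exact: measurable_sin_kernel2.
  exact: (measurableT_comp (mI _ mO) measurable_snd).
rewrite (_ : (fun xi => _) = (fun xi => fine (\int[Q]_t h (xi, t))%E)).
  apply: (measurableT_comp (fine_measurable _)) => //.
  exact: measurable_integral_param.
apply/funext => xi; case: asboolP => nz; rewrite /h/=.
  under [in RHS]eq_integral do rewrite indicE mem_set// mul1r.
  by rewrite orthant_restrict -integral_mkcond.
by under [in RHS]eq_integral do rewrite indicE memNset// mul0r; rewrite integral0.
Qed.

Lemma integral_damped_tail_cos eps xi : orthant eps ->
  lambda.-integrable setT (damped_tail_int Q eps (fun x => cos (dot x xi))) /\
  (\int[lambda]_x damped_tail_int Q eps (fun x => cos (dot x xi)) x =
   (\int[Q]_(t in orthant) abel_kernel_prod eps xi t)%:E)%E.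
Proof.
move=> e0; have [i E] := integral_damped_tail_int Qmin e0 (measurable_cos_dot xi)
  (fun x => normr_cos_le _).
split => //; have fin := integrable_fin_num measurableT i.
rewrite -(fineK fin) E; congr EFin; apply: eq_Rintegral => t; rewrite inE => tO.
by have [_ -> _] := window_trig xi e0 tO.
Qed.

Lemma integral_damped_tail_sin eps xi : orthant eps ->
  lambda.-integrable setT (damped_tail_int Q eps (fun x => sin (dot x xi))) /\
  (\int[lambda]_x damped_tail_int Q eps (fun x => sin (dot x xi)) x = 0)%E.
Proof.
move=> e0; have [i ->] := integral_damped_tail_int Qmin e0 (measurable_sin_dot xi)
  (fun x => normr_sin_le _).
split => //; apply: integral0_eq => t tO.
by have [_ _ ->] := window_trig xi e0 tO.
Qed.

End kernel_integrals.

Section abel_integrand.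
Context (R : realType) (n : nat).
Implicit Types (f : 'rV[R]_n -> R[i]) (x xi eps : 'rV[R]_n).

Lemma Re_abel_integrand f xi eps x :
  complex.Re (abel_integrand f xi eps x) = damping eps x *
    (complex.Re (f x) * cos (dot x xi) - complex.Im (f x) * sin (dot x xi)).
Proof.
rewrite /abel_integrand /expi -/(damping eps x).
by case: (f x) => a b; simpc => /=; ring.
Qed.

Lemma Im_abel_integrand f xi eps x :
  complex.Im (abel_integrand f xi eps x) = damping eps x *
    (complex.Re (f x) * sin (dot x xi) + complex.Im (f x) * cos (dot x xi)).
Proof.
rewrite /abel_integrand /expi -/(damping eps x).
by case: (f x) => a b; simpc => /=; ring.
Qed.

Lemma Re_mul_expi f xi x : complex.Re (f x * expi (dot x xi)) =
  complex.Re (f x) * cos (dot x xi) - complex.Im (f x) * sin (dot x xi).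
Proof. by rewrite /expi; case: (f x) => a b; simpc. Qed.

Lemma Im_mul_expi f xi x : complex.Im (f x * expi (dot x xi)) =
  complex.Re (f x) * sin (dot x xi) + complex.Im (f x) * cos (dot x xi).
Proof. by rewrite /expi; case: (f x) => a b; simpc. Qed.

Lemma cmeasurable_mul_expi f xi : cmeasurable setT f ->
  cmeasurable setT (fun x => f x * expi (dot x xi)).
Proof.
move=> [mr mi]; have mc := measurable_cos_dot xi; have ms := measurable_sin_dot xi.
split; [under eq_fun do rewrite Re_mul_expi|under eq_fun do rewrite Im_mul_expi].
  by apply: measurable_funB; exact: measurable_funM.
by apply: measurable_funD; exact: measurable_funM.
Qed.

Lemma cmeasurable_abel_integrand f xi eps : cmeasurable setT f ->
  cmeasurable setT (abel_integrand f xi eps).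
Proof.
move=> mf; have [mr mi] := cmeasurable_mul_expi xi mf.
have md := measurable_damping eps.
split.
  rewrite (_ : (fun x => _) = (fun x => damping eps x * complex.Re (f x * expi (dot x xi)))).
    exact: measurable_funM.
  by apply/funext => x; rewrite Re_abel_integrand Re_mul_expi.
rewrite (_ : (fun x => _) = (fun x => damping eps x * complex.Im (f x * expi (dot x xi)))).
  exact: measurable_funM.
by apply/funext => x; rewrite Im_abel_integrand Im_mul_expi.
Qed.

Lemma cintegrable_mul_expi f xi : cintegrable setT f ->
  cintegrable setT (fun x => f x * expi (dot x xi)).
Proof.
move=> [ir ii].
have mc := measurable_cos_dot xi; have ms := measurable_sin_dot xi.
have c1 x := normr_cos_le (dot x xi); have s1 x := normr_sin_le (dot x xi).
split.
  apply: eq_integrable (integrableB measurableT (integrable_bounded_mul ir mc c1)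
    (integrable_bounded_mul ii ms s1)) => // x _ /=.
  by rewrite Re_mul_expi EFinB.
apply: eq_integrable (integrableD measurableT (integrable_bounded_mul ir ms s1)
  (integrable_bounded_mul ii mc c1)) => // x _ /=.
by rewrite Im_mul_expi EFinD.
Qed.

End abel_integrand.

(** * The Abel transform *)

Lemma cvg_near_eq (T : Type) (U : topologicalType) (F : set_system T)
    (FF : Filter F) (u v : T -> U) (l : U) :
  (\forall x \near F, u x = v x) -> v x @[x --> F] --> l -> u x @[x --> F] --> l.
Proof.
move=> uv vl; apply: cvg_trans vl; apply: near_eq_cvg.
by apply: filterS uv => x ->.
Qed.

Section representation.
Context (R : realType) (n : nat).
Implicit Types (x t xi eps r : 'rV[R]_n).
Local Notation lambda := (@lebesgue_rV R n).
Variables P N P' N' : {sigma_finite_measure set 'rV[R]_n -> \bar R}.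
Hypothesis Pmin : forall r, orthant r -> P.-integrable orthant (EFin \o min_prod r).
Hypothesis Nmin : forall r, orthant r -> N.-integrable orthant (EFin \o min_prod r).
Hypothesis Pmin' : forall r, orthant r -> P'.-integrable orthant (EFin \o min_prod r).
Hypothesis Nmin' : forall r, orthant r -> N'.-integrable orthant (EFin \o min_prod r).
Variable f : 'rV[R]_n -> R[i].
Hypothesis mf : cmeasurable setT f.
Hypothesis fE : {ae lambda, forall x, no_zero_coord x ->
  f x = ((tail_mass P x - tail_mass N x) +i* (tail_mass P' x - tail_mass N' x))%C}.

(** Fubini's theorem, applied to each of the four Jordan parts: the sine
    contributions vanish because the windows are even. *)
Lemma fourier_eps_abel_kernel xi eps : orthant eps ->
  cintegrable setT (abel_integrand f xi eps) /\
  fourier_eps f xi eps =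
    ((\int[P]_(t in orthant) abel_kernel_prod eps xi t -
      \int[N]_(t in orthant) abel_kernel_prod eps xi t) +i*
     (\int[P']_(t in orthant) abel_kernel_prod eps xi t -
      \int[N']_(t in orthant) abel_kernel_prod eps xi t))%C.
Proof.
move=> e0.
have [mre mim] := cmeasurable_abel_integrand xi eps mf.
have ae_nz := ae_no_zero_coord R n.
pose c x := cos (dot x xi); pose s x := sin (dot x xi).
have [iPc Pc] := integral_damped_tail_cos Pmin xi e0.
have [iNc Nc] := integral_damped_tail_cos Nmin xi e0.
have [iPc' Pc'] := integral_damped_tail_cos Pmin' xi e0.
have [iNc' Nc'] := integral_damped_tail_cos Nmin' xi e0.
have [iPs Ps] := integral_damped_tail_sin Pmin xi e0.
have [iNs Ns] := integral_damped_tail_sin Nmin xi e0.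
have [iPs' Ps'] := integral_damped_tail_sin Pmin' xi e0.
have [iNs' Ns'] := integral_damped_tail_sin Nmin' xi e0.
have iRe := integrableB measurableT (integrableB measurableT iPc iNc)
  (integrableB measurableT iPs' iNs').
have iIm := integrableD measurableT (integrableB measurableT iPs iNs)
  (integrableB measurableT iPc' iNc').
have [] := eq_ae_Rintegral mre iRe.
  apply: filterS2 ae_nz fE => x nz /(_ nz) fx.
  rewrite Re_abel_integrand fx /= !damped_tail_intE// -!EFinB.
  by congr EFin; ring.
move=> intRe ReE.
have [] := eq_ae_Rintegral mim iIm.
  apply: filterS2 ae_nz fE => x nz /(_ nz) fx.
  rewrite Im_abel_integrand fx /= !damped_tail_intE// -!EFinB -EFinD.
  by congr EFin; ring.
move=> intIm ImE.
split; first by split.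
rewrite /fourier_eps /cintegral ReE ImE; congr (_ +i* _)%C.
  rewrite integralB//; [|exact: integrableB|exact: integrableB].
  rewrite (integralB measurableT iPc iNc) (integralB measurableT iPs' iNs').
  by rewrite Pc Nc Ps' Ns' -!EFinB /= !subr0.
rewrite integralD//; [|exact: integrableB|exact: integrableB].
rewrite (integralB measurableT iPc' iNc') (integralB measurableT iPs iNs).
by rewrite Pc' Nc' Ps Ns -!EFinB /= subr0 add0r.
Qed.

Lemma cvg_fourier_eps xi : no_zero_coord xi ->
  fourier_eps f xi eps @[eps --> @abel_filter R n] -->
  ((2 ^+ n)%:C%C *
    ((\int[P]_(t in orthant) sin_kernel xi t -
      \int[N]_(t in orthant) sin_kernel xi t) +i*
     (\int[P']_(t in orthant) sin_kernel xi t -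
      \int[N']_(t in orthant) sin_kernel xi t))%C : R[i]).
Proof.
move=> xi0; have FF := abel_filter_proper R n.
have near_orthant : @abel_filter R n orthant.
  by apply: withinT; exact: nbhs_filter.
apply/cvg_complexP; simpc; rewrite /=; split.
  rewrite mulrBr.
  apply: (cvg_near_eq FF _ (cvgB (cvg_abel_kernel_integral Pmin xi0)
    (cvg_abel_kernel_integral Nmin xi0))).
  apply: filterS near_orthant => eps e0.
  by have [_ /(congr1 (@complex.Re R)) /= ->] := fourier_eps_abel_kernel xi e0.
rewrite mulrBr.
apply: (cvg_near_eq FF _ (cvgB (cvg_abel_kernel_integral Pmin' xi0)
  (cvg_abel_kernel_integral Nmin' xi0))).
apply: filterS near_orthant => eps e0.
by have [_ /(congr1 (@complex.Im R)) /= ->] := fourier_eps_abel_kernel xi e0.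
Qed.

End representation.

(** The damping factor is at most [1] on the orthant and tends to [1]. *)
Lemma cvg_fourier_eps_fourier (R : realType) n (f : 'rV[R]_n -> R[i]) xi :
  cmeasurable setT f -> cintegrable setT f ->
  fourier_eps f xi eps @[eps --> @abel_filter R n] --> fourier f xi.
Proof.
move=> mf intf; have FF := abel_filter_proper R n.
have [mr mi] := cmeasurable_mul_expi xi mf.
have [ir ii] := cintegrable_mul_expi xi intf.
have dto1 x : damping eps x @[eps --> @abel_filter R n] --> (1 : R).
  have -> : (1 : R) = expR (- \sum_(k < n) (0 : 'rV[R]_n) ord0 k * `|x ord0 k|).
    by rewrite big1 ?oppr0 ?expR0// => k _; rewrite mxE mul0r.
  apply: (continuous_cvg _ (@continuous_expR R _)); apply: cvgN.
  apply: cvg_big => // [z|k _].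
    by apply: cvgD; [exact: cvg_fst|exact: cvg_snd].
  by apply: cvgM; [exact: cvg_coord|exact: cvg_cst].
have d1 eps x : orthant eps -> damping eps x <= 1.
  move=> e0; rewrite -expR0 ler_expR oppr_le0 sumr_ge0// => k _.
  by rewrite mulr_ge0// ltW.
have dct (h : 'rV[R]_n -> R) : measurable_fun setT h ->
    (@lebesgue_rV R n).-integrable setT (EFin \o h) ->
    \int[@lebesgue_rV R n]_x (damping eps x * h x) @[eps --> @abel_filter R n] -->
    \int[@lebesgue_rV R n]_x h x.
  move=> mh ih; apply: (@cvg_Rintegral_within _ _ _ _ _ _ _ _ _ _
    (fun x => `|h x|)) => //.
  - by move=> eps _; apply: measurable_funM => //; exact: measurable_damping.
  - exact: integrable_norm.
  - move=> eps x e0 _; rewrite normrM ger0_norm ?damping_ge0//.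
    by rewrite ler_piMl// d1.
  - move=> x _; rewrite -[X in _ --> X]mul1r; apply: cvgM; last exact: cvg_cst.
    exact: dto1.
apply/cvg_complexP; split; rewrite /fourier_eps /fourier /cintegral/=.
  apply: (cvg_near_eq FF _ (dct _ mr ir)); apply: nearW => eps.
  by apply: eq_Rintegral => x _; rewrite Re_abel_integrand Re_mul_expi.
apply: (cvg_near_eq FF _ (dct _ mi ii)); apply: nearW => eps.
by apply: eq_Rintegral => x _; rewrite Im_abel_integrand Im_mul_expi.
Qed.

Unset Implicit Arguments.

Theorem proposition3p6 (R : realType) (d : nat) (hd : (1 <= d)%N)
    (g : 'rV[R]_d -> R[i]) (mu : complex_radon R d) (hg : upper_tail_potential g mu)
    (f : 'rV[R]_d -> R[i]) (hf : even_extension g f) :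
  [/\ forall xi, no_zero_coord xi ->
        [/\ abel_exists f xi,
            radon_integrable mu (sin_kernel xi),
            abel_fourier f xi =
              (2 ^+ d)%:C%C * radon_integral mu (sin_kernel xi) &
            ((Normc.normc (abel_fourier f xi))%:E <=
              (2 ^+ d)%:E * tail_moment mu (inv_abs_coord xi))%E],
      forall K : set 'rV[R]_d, compact K -> K `<=` no_zero_coord ->
        {within K, continuous (fun xi =>
          (2 ^+ d)%:C%C * radon_integral mu (sin_kernel xi) : R[i])},
      cmeasurable setT (abel_fourier f) &
      cintegrable setT f ->
        {ae @lebesgue_rV R d, forall xi, abel_fourier f xi = fourier f xi}].
Proof.
have [mg gE tail] := hg; have [mf fg] := hf.
have [V [P [N [P' [N' [VE intE leV normc_le]]]]]] := radon_jordan mu.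
have mO := @measurable_orthant R d.
have Vmin r : orthant r -> V.-integrable orthant (EFin \o min_prod r).
  move=> r0; apply/integrableP; split.
    by apply/measurable_EFinP; apply: measurable_funS (measurable_min_prod r).
  apply: le_lt_trans (tail r r0); rewrite /tail_moment -VE.
  rewrite le_eqVlt; apply/orP; left; apply/eqP; apply: eq_integral => t.
  by rewrite inE => tO; rewrite gee0_abs// lee_fin min_prod_ge0.
have Qmin (Q : {sigma_finite_measure set 'rV[R]_d -> \bar R}) :
    (forall A, measurable A -> (Q A <= V A)%E) ->
    forall r, orthant r -> Q.-integrable orthant (EFin \o min_prod r).
  move=> QV r r0; apply: (integrable_le_measure QV mO (measurable_min_prod r)).
  exact: Vmin.
have Pmin := Qmin P (fun A mA => let: And4 h _ _ _ := leV A mA in h).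
have Nmin := Qmin N (fun A mA => let: And4 _ h _ _ := leV A mA in h).
have Pmin' := Qmin P' (fun A mA => let: And4 _ _ h _ := leV A mA in h).
have Nmin' := Qmin N' (fun A mA => let: And4 _ _ _ h := leV A mA in h).
have fE : {ae @lebesgue_rV R d, forall x, no_zero_coord x ->
    f x = ((tail_mass P x - tail_mass N x) +i* (tail_mass P' x - tail_mass N' x))%C}.
  apply: filterS (ae_abs_coord gE) => x gx nz.
  by rewrite fg// gx// /radon_measure intE.
have FF := abel_filter_proper R d.
have hC : hausdorff_space R[i] by exact: (@norm_hausdorff R[i] R[i]).
have cv xi : no_zero_coord xi -> fourier_eps f xi eps @[eps --> @abel_filter R d] -->
    ((2 ^+ d)%:C%C * radon_integral mu (sin_kernel xi) : R[i]).
  by move=> nz; rewrite intE; exact: (cvg_fourier_eps Pmin Nmin Pmin' Nmin' mf fE nz).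
have abelE xi : no_zero_coord xi ->
    abel_fourier f xi = (2 ^+ d)%:C%C * radon_integral mu (sin_kernel xi).
  move=> nz; rewrite /abel_fourier; case: asboolP => // _.
  exact: (cvg_lim hC (cv xi nz)).
have iV xi : no_zero_coord xi -> V.-integrable orthant (EFin \o sin_kernel xi).
  by move=> nz; exact: integrable_sin_kernel.
split.
- move=> xi nz; split.
  + split; last by apply/cvg_ex; eexists; exact: cv.
    by move=> eps e0; exact: (fourier_eps_abel_kernel Pmin Nmin Pmin' Nmin' mf fE xi e0).1.
  + by rewrite /radon_integrable -VE; exact: iV.
  + exact: abelE.
  + rewrite abelE// Normc.normcM EFinM.
    have -> : Normc.normc ((2 ^+ d)%:C%C : R[i]) = 2 ^+ d.
      by rewrite /= expr0n/= addr0 sqrtr_sqr ger0_norm// exprn_ge0.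
    apply: lee_wpmul2l; first by rewrite lee_fin exprn_ge0.
    have sO : measurable_fun orthant (sin_kernel xi).
      by apply: measurable_funS (measurable_sin_kernel xi).
    apply: (@le_trans _ _ (\int[V]_(t in orthant) `|sin_kernel xi t|)%:E).
      by rewrite lee_fin; apply: normc_le; [exact: measurable_sin_kernel|exact: iV].
    rewrite /Rintegral fineK; last first.
      apply: integrable_fin_num => //; exact: integrable_norm (iV xi nz).
    rewrite /tail_moment -VE; apply: ge0_le_integral => //.
    * by apply/measurable_EFinP; exact: measurableT_comp.
    * by apply/measurable_EFinP; apply: measurable_funS (measurable_min_prod _).
    * by move=> t tO; rewrite lee_fin; exact: normr_sin_kernel_le.
- move=> K _ Knz; apply: continuous_in_subspaceT => xi; rewrite inE => /Knz nz.
  have FX := nbhs_filter xi.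
  have cs Q Qm := @continuous_sin_kernel_integral R d Q Qm xi nz.
  have re_ z : complex.Re ((2 ^+ d)%:C%C * z : R[i]) = 2 ^+ d * complex.Re z.
    by case: z => a b; simpc.
  have im_ z : complex.Im ((2 ^+ d)%:C%C * z : R[i]) = 2 ^+ d * complex.Im z.
    by case: z => a b; simpc.
  apply/cvg_complexP; split.
    under eq_fun do rewrite re_ intE/=.
    rewrite re_ intE/=; apply: cvgM; first exact: cvg_cst.
    exact: (cvgB (cs _ Pmin) (cs _ Nmin)).
  under eq_fun do rewrite im_ intE/=.
  rewrite im_ intE/=; apply: cvgM; first exact: cvg_cst.
  exact: (cvgB (cs _ Pmin') (cs _ Nmin')).
- have abelE' : abel_fourier f = fun xi =>
      ((2 ^+ d * ((if `[< no_zero_coord xi >] then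
                     \int[P]_(t in orthant) sin_kernel xi t else 0) -
                  (if `[< no_zero_coord xi >] then
                     \int[N]_(t in orthant) sin_kernel xi t else 0))) +i*
       (2 ^+ d * ((if `[< no_zero_coord xi >] then
                     \int[P']_(t in orthant) sin_kernel xi t else 0) -
                  (if `[< no_zero_coord xi >] then
                     \int[N']_(t in orthant) sin_kernel xi t else 0))))%C.
    apply/funext => xi; case: asboolP => nz.
      by rewrite abelE// intE; simpc.
    by rewrite /abel_fourier; case: asboolP => // _; rewrite subrr mulr0.
  rewrite abelE'; split => /=; apply: measurable_funM => //;
    apply: measurable_funB; exact: measurable_sin_kernel_integral.
- move=> intf; apply: filterS (ae_no_zero_coord R d) => xi nz.
  rewrite abelE//; apply: (cvg_unique hC (cv xi nz)).
  exact: cvg_fourier_eps_fourier.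
Qed.
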